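(* Let $E$ be a countable set and let $r:E\times E\to\mathbb{R}$ (negative values allowed) satisfy $r(x,x)=0$ for all $x\in E$ and $\sup_{x\in E}\sum_{y\in E}|r(x,y)|<\infty$. Let $S_t=e^{tL}$, $t\ge 0$, be the semigroup on bounded functions $E\to\mathbb{R}$ generated by $$Lf(x)=\sum_{y\in E}r(x,y)\,[f(y)-f(x)].$$ Given $f:E\to\mathbb{R}$ bounded, define $$f^\uparrow(\eta^+,\eta^-)=\sum_{x\in E}(\eta^+(x)-\eta^-(x))f(x).$$ Then for all $x\in E$ and $t\ge0$, $$S_tf(x)=\mathbb{E}_{(\delta_x,0)}\, f^\uparrow(\eta^+_t,\eta^-_t),$$ where $(\eta^+_t,\eta^-_t)_{t\ge0}$ is the branching particle/antiparticle system with generator $L^\uparrow$ defined in the context, started from a single particle at $x$ and no antiparticles.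
   Context: Write $r^+(x,y)=\max(r(x,y),0)$ and $r^-(x,y)=\max(-r(x,y),0)$. The configurations $\eta^+,\eta^-\in\mathbb{N}_0^E$ (with finite total number of particles and antiparticles) give the numbers $\eta^+(x)$ of particles and $\eta^-(x)$ of antiparticles at each site $x\in E$; $\delta_x$ is the configuration with exactly one particle, located at $x$, and $0$ is the empty configuration. The process $(\eta^+_t,\eta^-_t)_{t\ge 0}$ is the (non-explosive) continuous-time Markov jump process with generator $L^\uparrow=L^\uparrow_++L^\uparrow_-$, where $$L_+^\uparrow f(\eta^+,\eta^-)=\sum_{x,y}r^+(x,y)\eta^+(x)[f(\eta^++\delta_y-\delta_x,\eta^-)-f(\eta^+,\eta^-)]+\sum_{x,y}r^-(x,y)\eta^+(x)[f(\eta^++\delta_x,\eta^-+\delta_y)-f(\eta^+,\eta^-)],$$ $$L_-^\uparrow f(\eta^+,\eta^-)=\sum_{x,y}r^+(x,y)\eta^-(x)[f(\eta^+,\eta^-+\delta_y-\delta_x)-f(\eta^+,\eta^-)]+\sum_{x,y}r^-(x,y)\eta^-(x)[f(\eta^++\delta_y,\eta^-+\delta_x)-f(\eta^+,\eta^-)].$$ That is, particles and antiparticles jump independently from $x$ to $y$ at rate $r^+(x,y)$; a particle at $x$ branches at rate $r^-(x,y)$ into two particles at $x$ and one antiparticle at $y$; an antiparticle at $x$ branches at rate $r^-(x,y)$ into two antiparticles at $x$ and one particle at $y$. $\mathbb{E}_{(\eta^+,\eta^-)}$ denotes expectation for the process started from $(\eta^+,\eta^-)$. *)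

(* Defs.v *)
From HB Require Import structures.
From mathcomp Require Import all_boot all_order all_algebra finmap multiset.
From mathcomp Require Import all_classical all_reals all_analysis.

Set Implicit Arguments.
Unset Strict Implicit.
Unset Printing Implicit Defensive.

Import Order.TTheory GRing.Theory Num.Theory.
Import numFieldNormedType.Exports.

Local Open Scope classical_set_scope.
Local Open Scope ring_scope.

(* Unordered sum of a real family: the sum of the positive parts minus the sum
   of the negative parts. It is the usual sum when the family is absolutely
   summable, the only case in which it is used. *)
Definition asum (R : realType) (I : choiceType) (a : I -> R) : R :=
  fine (\esum_(i in [set: I]) (Num.max (a i) 0)%:E
        - \esum_(i in [set: I]) (Num.max (- a i) 0)%:E)%E.

Section MarkovJumpProcess.
Context {R : realType} {S : countType}.
Implicit Types (p : R -> S -> S -> R) (G : (S -> R) -> S -> R).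

Record transition_function p : Prop := TransitionFunction {
  transition_ge0 : forall (t : R) (c c' : S), 0 <= t -> 0 <= p t c c' ;
  transition_total : forall (t : R) (c : S), 0 <= t ->
    (\esum_(c' in [set: S]) (p t c c')%:E = 1)%E ;
  transition_zero : forall c c', p 0 c c' = (c == c')%:R ;
  transition_add : forall (s t : R) (c c' : S), 0 <= s -> 0 <= t ->
    p (s + t) c c' = asum (fun e => p s c e * p t e c')
}.

Definition transition_op p (t : R) (F : S -> R) (c : S) : R :=
  asum (fun c' => p t c c' * F c').

(* Jump rates may be unbounded on S, so the difference quotients converge
   pointwise, not uniformly. For a conservative jump generator with finite
   rates (the sum of the rates out of each state is finite), this convergence
   for every bounded F is the same as the convergence of (p t c c' - p 0 c c')/t
   to the corresponding entry of the rate matrix, for all c and c'. *)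
Definition has_generator p G : Prop :=
  forall F : S -> R, bounded_fun F -> forall c : S,
    (transition_op p t F c - F c) / t @[t --> 0^'+] --> G F c.

Context {d : measure_display} {Omega : measurableType d}.
Implicit Types (P : probability Omega R) (X : R -> Omega -> S).

Definition natural_filtration X (t : R) : set (set Omega) :=
  <<s [set A | exists (s : R) (c : S), [/\ 0 <= s, s <= t & A = X s @^-1` [set c]] ] >>.

(* P(X_{t+h} = c' | F_t) = p h (X_t) c', tested on the events A `&` {X_t = c}
   with A in F_t *)
Definition markov_property P X p : Prop :=
  forall (t h : R) (A : set Omega) (c c' : S), 0 <= t -> 0 <= h ->
    natural_filtration X t A ->
    P (A `&` X t @^-1` [set c] `&` X (t + h) @^-1` [set c'])
    = (P (A `&` X t @^-1` [set c]) * (p h c c')%:E)%E.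

(* Right-continuous with left limits for the discrete topology of S: finitely
   many jumps on each bounded time interval, that is, no explosion. *)
Definition jump_path (u : R -> S) : Prop :=
  (forall t : R, 0 <= t -> \forall s \near t^'+, u s = u t) /\
  (forall t : R, 0 < t -> exists c, \forall s \near t^'-, u s = c).

(* X (restricted to nonnegative times) is a non-explosive Markov jump process
   with generator G, started from c0. *)
Record markov_jump_process G (c0 : S) P X : Prop := MarkovJumpProcess {
  process_measurable : forall (t : R) (c : S), 0 <= t -> measurable (X t @^-1` [set c]) ;
  process_start : P (X 0 @^-1` [set c0]) = 1%E ;
  process_paths : {ae P, forall w, jump_path (X ^~ w)} ;
  process_markov : exists p,
    [/\ transition_function p, has_generator p G & markov_property P X p]
}.

End MarkovJumpProcess.

Section ParticleSystem.
Context {R : realType} {E : countType}.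
Variable r : E -> E -> R.

Definition rpos (x y : E) : R := Num.max (r x y) 0.
Definition rneg (x y : E) : R := Num.max (- r x y) 0.

Definition gen (f : E -> R) (x : E) : R :=
  asum (fun y => r x y * (f y - f x)).

(* exp(t L) f, as the exponential series of the bounded operator L *)
Definition semigroup (t : R) (f : E -> R) (x : E) : R :=
  limn (series (fun n => t ^+ n / n`!%:R * iter n gen f x)).

(* Particles (first component) and antiparticles (second component). A finite
   multiset is a finitely supported function E -> nat, which is the same as a
   configuration with a finite total number of particles. *)
Definition config : Type := ({mset E} * {mset E})%mset%type.

(* In a term with factor (c.1 x)%:R or (c.2 x)%:R, the truncated subtraction of
   [mset x] matters only if x is occupied, where it is exact. *)
Definition gen_up_plus (F : config -> R) (c : config) : R :=
  asum (fun z : E * E => let: (x, y) := z in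
    rpos x y * (c.1 x)%:R *
      (F ((c.1 `+` [mset y]) `\` [mset x], c.2)%mset - F c)) +
  asum (fun z : E * E => let: (x, y) := z in
    rneg x y * (c.1 x)%:R *
      (F (c.1 `+` [mset x], c.2 `+` [mset y])%mset - F c)).

Definition gen_up_minus (F : config -> R) (c : config) : R :=
  asum (fun z : E * E => let: (x, y) := z in
    rpos x y * (c.2 x)%:R *
      (F (c.1, (c.2 `+` [mset y]) `\` [mset x])%mset - F c)) +
  asum (fun z : E * E => let: (x, y) := z in
    rneg x y * (c.2 x)%:R *
      (F (c.1 `+` [mset y], c.2 `+` [mset x])%mset - F c)).

Definition gen_up (F : config -> R) (c : config) : R :=
  gen_up_plus F c + gen_up_minus F c.

Definition lift_up (f : E -> R) (c : config) : R :=
  \sum_(x \in [set: E]) ((c.1 x)%:R - (c.2 x)%:R) * f x.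

End ParticleSystem.

Arguments config E : clear implicits.

(* Main.v *)
Require Import Defs.
From HB Require Import structures.
From mathcomp Require Import all_boot all_order all_algebra finmap multiset.
From mathcomp Require Import all_classical all_reals all_analysis.
From mathcomp Require Import measurable_realfun ring lra.

Set Implicit Arguments.
Unset Strict Implicit.
Unset Printing Implicit Defensive.

Import Order.TTheory GRing.Theory Num.Theory.
Import numFieldNormedType.Exports.

Local Open Scope classical_set_scope.
Local Open Scope ring_scope.

(* Each jump changes the total population by 0 or 2 at a rate linear in the
   population, so [weight = (population + 1)^2] satisfies [gen_up weight <= 4 K
   weight], while [gen_up (lift_up g) = lift_up (gen g)]. For bounded F,
   [u_t = P_t F] solves the backward equation: u has right derivative
   [gen_up u_t]. A maximum principle, which only needs control of the
   supersolution where the weight is large, compares u with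
   [v_t + (eps + delta t) exp (4 K t) weight], where v is the lift of the N-th
   Taylor polynomial of [t |-> exp (t L) f]; v solves the backward equation up to
   an error [delta * weight] with [delta -> 0] as N grows. Truncating [lift_up f]
   at large weight and removing the truncation gives
   [P_t (lift_up f) = lift_up (S_t f)]. *)

(** * Absolutely summable families *)

(** [has_generator] speaks of bounded functions and of pointwise limits, whereas [lift_up f] and the
    jump rates are unbounded: the generator cannot be applied to [lift_up f] directly, and nothing
    says in advance that its expectation exists. Integrability comes out of the comparison itself:
    with the zero function as approximate solution, it bounds the expectation of truncations of
    [weight], uniformly in the truncation. The square makes [weight] grow faster than [lift_up g],
    which is linear in the population. Hence [v + eps * weight] exceeds any given bound far out,
    where the rates are not controlled; on the remaining states the rates are bounded. Taylor
    polynomials replace the semigroup because their time derivatives and their images under [gen_up]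
    are finite sums, so that no limit has to be exchanged with an unbounded generator. *)

Section AbsolutelySummable.
Context {R : realType}.
Implicit Types I J : choiceType.

Definition asummable I (a : I -> R) : Prop :=
  (\esum_(i in [set: I]) `|a i|%:E < +oo)%E.

Lemma esum_ge0_fin I (a : I -> R) : (forall i, 0 <= a i) -> asummable a ->
  \esum_(i in [set: I]) (a i)%:E \is a fin_num.
Proof.
move=> a0 sa; rewrite ge0_fin_numE; last first.
  by apply: esum_ge0 => i _; rewrite lee_fin.
by under eq_esum do rewrite -(ger0_norm (a0 _)).
Qed.

Lemma le_asummable I (b a : I -> R) :
  (forall i, `|a i| <= b i) -> asummable b -> asummable a.
Proof.
move=> ab; apply: le_lt_trans; apply: le_esum => i _; rewrite lee_fin.
by rewrite (le_trans (ab i)) ?ler_norm.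
Qed.

Lemma asummable_norm I (a : I -> R) : asummable a -> asummable (fun i => `|a i|).
Proof.
by move=> sa; rewrite /asummable; under eq_esum do rewrite normr_id.
Qed.

Lemma asummableD I (a b : I -> R) : asummable a -> asummable b ->
  asummable (fun i => a i + b i).
Proof.
move=> sa sb; apply: le_lt_trans (lte_add_pinfty sa sb).
rewrite -esumD; try by move=> i _; rewrite lee_fin.
by apply: le_esum => i _; rewrite -EFinD lee_fin ler_normD.
Qed.

Lemma asummableN I (a : I -> R) : asummable a -> asummable (fun i => - a i).
Proof.
by move=> sa; rewrite /asummable; under eq_esum do rewrite normrN.
Qed.

Lemma esumZl I (k : R) (a : I -> R) : 0 <= k -> (forall i, 0 <= a i) ->
  (\esum_(i in [set: I]) (k * a i)%:E = k%:E * \esum_(i in [set: I]) (a i)%:E)%E.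
Proof.
move=> k0 a0; have [->|kn0] := eqVneq k 0.
  by rewrite mul0e esum1// => i _; rewrite mul0r.
have kp : 0 < k by rewrite lt_neqAle eq_sym kn0.
have key l (b : I -> R) : 0 <= l -> (forall i, 0 <= b i) ->
    (\esum_(i in [set: I]) (l * b i)%:E <= l%:E * \esum_(i in [set: I]) (b i)%:E)%E.
  move=> l0 b0; apply: ge_ereal_sup => /= _ [X [finX _]] <-.
  under eq_fsbigr do rewrite EFinM.
  rewrite -ge0_mule_fsumr; last by move=> i; rewrite lee_fin.
  by rewrite lee_wpmul2l ?lee_fin//; apply: ereal_sup_ubound; exists X.
apply/eqP; rewrite eq_le key//=.
have := key k^-1 (fun i => k * a i); rewrite invr_ge0 => /(_ k0).
have -> : (fun i => (k^-1 * (k * a i))%:E) = (fun i => (a i)%:E).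
  by apply/funext => i; rewrite mulKf.
move=> /(_ (fun i => mulr_ge0 k0 (a0 i))) H.
have k0E : (0 <= k%:E)%E by rewrite lee_fin.
have := lee_wpmul2l k0E H.
by rewrite muleA -EFinM divff// mul1e.
Qed.

Lemma asummableZ I (k : R) (a : I -> R) : asummable a ->
  asummable (fun i => k * a i).
Proof.
move=> sa; rewrite /asummable; under eq_esum do rewrite normrM.
by rewrite esumZl// lte_mul_pinfty// lee_fin.
Qed.

Lemma asummableB I (a b : I -> R) : asummable a -> asummable b ->
  asummable (fun i => a i - b i).
Proof. by move=> sa sb; apply: asummableD => //; exact: asummableN. Qed.

(** The positive and negative parts in [asum] may be replaced by any splitting into summable
    nonnegative families: [u + c = v + b] pointwise, and [esum] is additive on nonnegative
    families. *)
Lemma asum_split I (b c : I -> R) : (forall i, 0 <= b i) -> (forall i, 0 <= c i) ->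
  asummable b -> asummable c ->
  asum (fun i => b i - c i) =
  fine (\esum_(i in [set: I]) (b i)%:E) - fine (\esum_(i in [set: I]) (c i)%:E).
Proof.
move=> b0 c0 sb sc; rewrite /asum.
pose u i := Num.max (b i - c i) 0; pose v i := Num.max (- (b i - c i)) 0.
have u0 i : 0 <= u i by rewrite le_max lexx orbT.
have v0 i : 0 <= v i by rewrite le_max lexx orbT.
have sbc := asummableB sb sc.
have su : asummable u.
  apply: le_asummable (asummable_norm sbc) => i; rewrite ger0_norm ?u0//.
  by rewrite ge_max normr_ge0 ler_norm.
have sv : asummable v.
  apply: le_asummable (asummable_norm sbc) => i; rewrite ger0_norm ?v0//.
  by rewrite ge_max normr_ge0 -normrN ler_norm.
have /(congr1 fine) : (\esum_(i in [set: I]) (u i)%:E + \esum_(i in [set: I]) (c i)%:E =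
        \esum_(i in [set: I]) (v i)%:E + \esum_(i in [set: I]) (b i)%:E)%E.
  rewrite -!esumD; try by move=> i _; rewrite lee_fin.
  apply: eq_esum => i _; rewrite -!EFinD; congr EFin; rewrite /u /v.
  by have [h|h] := leP 0 (b i - c i); [rewrite max_r|rewrite max_l]; lra.
move=> e; rewrite !fineD ?esum_ge0_fin// in e.
rewrite fineB; [|exact: esum_ge0_fin u0 su|exact: esum_ge0_fin v0 sv].
by move: e; rewrite /u /v; lra.
Qed.

Lemma asum_ge0E I (a : I -> R) : (forall i, 0 <= a i) ->
  asum a = fine (\esum_(i in [set: I]) (a i)%:E).
Proof.
move=> a0; rewrite /asum [X in (_ - X)%E]esum1 ?sube0.
  by congr fine; apply: eq_esum => i _; rewrite max_l.
by move=> i _; rewrite max_r// oppr_le0.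
Qed.

Lemma EFin_asum I (a : I -> R) : (forall i, 0 <= a i) -> asummable a ->
  ((asum a)%:E = \esum_(i in [set: I]) (a i)%:E)%E.
Proof. by move=> a0 sa; rewrite asum_ge0E// fineK// esum_ge0_fin. Qed.

Lemma eq_asum I (a b : I -> R) : a =1 b -> asum a = asum b.
Proof. by move=> /funext ->. Qed.

Lemma asummable_pos I (a : I -> R) : asummable a -> asummable (fun i => Num.max (a i) 0).
Proof.
move=> sa; apply: le_asummable (asummable_norm sa) => i.
by rewrite ger0_norm ?le_max ?lexx ?orbT// ge_max normr_ge0 ler_norm.
Qed.

Lemma max0_sub (x : R) : x = Num.max x 0 - Num.max (- x) 0.
Proof.
by have [h|h] := leP 0 x; [rewrite max_r|rewrite max_l]; lra.
Qed.

Lemma asumE I (a : I -> R) : asummable a ->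
  asum a = asum (fun i => Num.max (a i) 0) - asum (fun i => Num.max (- a i) 0).
Proof.
move=> sa.
have p0 (b : I -> R) i : 0 <= Num.max (b i) 0 by rewrite le_max lexx orbT.
rewrite (asum_ge0E (p0 a)) (asum_ge0E (p0 (fun i => - a i))) -asum_split.
- by apply: eq_asum => i; exact: max0_sub.
- exact: p0.
- exact: (p0 (fun i => - a i)).
- exact: asummable_pos.
- exact: asummable_pos (asummableN sa).
Qed.

Lemma asumB I (a b : I -> R) : asummable a -> asummable b ->
  asum (fun i => a i - b i) = asum a - asum b.
Proof.
move=> sa sb.
have p0 (c : I -> R) i : 0 <= Num.max (c i) 0 by rewrite le_max lexx orbT.
have sp (c : I -> R) := @asummable_pos I c.
(* Regrouped in this way, both families are nonnegative and [asum_split] applies, although they are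
   not the positive and negative parts of [a i - b i]. *)
have -> : (fun i => a i - b i) = (fun i =>
   (Num.max (a i) 0 + Num.max (- b i) 0) - (Num.max (- a i) 0 + Num.max (b i) 0)).
  by apply/funext => i; rewrite {1}[a i]max0_sub {1}[b i]max0_sub; lra.
have sNa := sp _ (asummableN sa); have sNb := sp _ (asummableN sb).
rewrite asum_split; try by [move=> i; rewrite addr_ge0|apply: asummableD => //; exact: sp].
under eq_esum do rewrite EFinD.
under [X in _ - fine X]eq_esum do rewrite EFinD.
rewrite !esumD; try by move=> i _; rewrite lee_fin.
rewrite !fineD ?esum_ge0_fin//; try exact: sp.
rewrite (asumE sa) (asumE sb) (asum_ge0E (p0 a)) (asum_ge0E (p0 b))
  (asum_ge0E (p0 (fun i => - a i))) (asum_ge0E (p0 (fun i => - b i)));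
  first lra.
all: by move=> i *; rewrite ?lee_fin ?addr_ge0// ?(p0 a) ?(p0 b)
  ?(p0 (fun i => - a i)) ?(p0 (fun i => - b i)).
Qed.

Lemma asum0 I : asum (fun _ : I => 0 : R) = 0.
Proof. by rewrite asum_ge0E// esum1. Qed.

Lemma asummable0 I : asummable (fun _ : I => 0 : R).
Proof. by rewrite /asummable esum1// => i _; rewrite normr0. Qed.

Lemma asumN I (a : I -> R) : asummable a -> asum (fun i => - a i) = - asum a.
Proof.
move=> sa; rewrite -[RHS]add0r -(asum0 I) -asumB//; last exact: asummable0.
by apply: eq_asum => i; rewrite add0r.
Qed.

Lemma asumD I (a b : I -> R) : asummable a -> asummable b ->
  asum (fun i => a i + b i) = asum a + asum b.
Proof.
move=> sa sb; rewrite -[asum b]opprK -asumN// -asumB//; last exact: asummableN.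
by apply: eq_asum => i; rewrite opprK.
Qed.

Lemma asum_ge0 I (a : I -> R) : (forall i, 0 <= a i) -> 0 <= asum a.
Proof.
move=> a0; rewrite asum_ge0E// fine_ge0// esum_ge0// => i _.
by rewrite lee_fin.
Qed.

Lemma ler_asum I (a b : I -> R) : asummable a -> asummable b ->
  (forall i, a i <= b i) -> asum a <= asum b.
Proof.
move=> sa sb ab; rewrite -subr_ge0 -asumB//; apply: asum_ge0 => i.
by rewrite subr_ge0.
Qed.

Lemma ler_norm_asum I (a : I -> R) : asummable a ->
  `|asum a| <= asum (fun i => `|a i|).
Proof.
move=> sa; have sn := asummable_norm sa; rewrite ler_norml lerNl -asumN//.
apply/andP; split; apply: ler_asum => //; first exact: asummableN.
- by move=> i; rewrite -normrN ler_norm.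
- by move=> i; rewrite ler_norm.
Qed.

Lemma asumZ I (k : R) (a : I -> R) : asummable a ->
  asum (fun i => k * a i) = k * asum a.
Proof.
move=> sa; wlog k0 : k / 0 <= k.
  move=> H; have [/H//|k0] := leP 0 k.
  rewrite -[k]opprK; under eq_fun do rewrite mulNr.
  by rewrite asumN ?H ?mulNr//; [rewrite oppr_ge0 ltW|exact: asummableZ].
have p0 (c : I -> R) i : 0 <= Num.max (c i) 0 by rewrite le_max lexx orbT.
have e (c : I -> R) : asummable c -> (forall i, 0 <= c i) ->
    asum (fun i => k * c i) = k * asum c.
  move=> sc c0; apply: EFin_inj; rewrite EFinM !EFin_asum ?esumZl//.
    by move=> i; exact: mulr_ge0.
  exact: asummableZ.
have sp := asummable_pos sa; have sn := asummable_pos (asummableN sa).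
rewrite [in RHS](asumE sa) mulrBr -(e _ sp (p0 a)) -(e _ sn (p0 (fun i => - a i))).
rewrite -asumB; [|exact: asummableZ..].
by apply: eq_asum => i; rewrite -mulrBr -max0_sub.
Qed.

Lemma asummable_single I (a : I -> R) (j : I) : (forall i, i != j -> a i = 0) ->
  asummable a.
Proof.
move=> a0; rewrite /asummable (esumID [set j]); last by move=> i _; rewrite lee_fin.
rewrite [X in (_ + X)%E]esum1 ?adde0; last first.
  by move=> i [_ /= /eqP/a0 ->]; rewrite normr0.
by rewrite setTI esum_set1 ?ltry ?lee_fin.
Qed.

Lemma asum_single I (a : I -> R) (j : I) : (forall i, i != j -> a i = 0) ->
  asum a = a j.
Proof.
move=> a0; have sa := asummable_single a0; rewrite (asumE sa).
have e (b : I -> R) : (forall i, 0 <= b i) -> (forall i, i != j -> b i = 0) -> asum b = b j.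
  move=> b0 bj; rewrite asum_ge0E// (esumID [set j]); last by move=> i _; rewrite lee_fin.
  rewrite [X in (_ + X)%E]esum1 ?adde0; last first.
    by move=> i [_ /= /eqP/bj ->].
  by rewrite setTI esum_set1 ?lee_fin.
have p0 (c : I -> R) i : 0 <= Num.max (c i) 0 by rewrite le_max lexx orbT.
by rewrite (e _ (p0 a)) ?(e _ (p0 (fun i => - a i))) -?max0_sub// => i /a0 ->;
  rewrite ?oppr0 maxxx.
Qed.

Lemma asummable_sum I (T : Type) (s : seq T) (a : T -> I -> R) :
  (forall j, asummable (a j)) -> asummable (fun i => \sum_(j <- s) a j i).
Proof.
move=> sa; elim: s => [|j s IH].
  by under eq_fun do rewrite big_nil; exact: asummable0.
by under eq_fun do rewrite big_cons; exact: asummableD.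
Qed.

Lemma asum_sum I (T : Type) (s : seq T) (a : T -> I -> R) :
  (forall j, asummable (a j)) ->
  asum (fun i => \sum_(j <- s) a j i) = \sum_(j <- s) asum (a j).
Proof.
move=> sa; elim: s => [|j s IH].
  by under eq_fun do rewrite big_nil; rewrite big_nil asum0.
under eq_fun do rewrite big_cons; rewrite big_cons asumD ?IH//.
exact: asummable_sum.
Qed.

Lemma esum_pair I J (a : I * J -> \bar R) : (forall k, 0 <= a k)%E ->
  (\esum_(k in [set: I * J]) a k =
   \esum_(i in [set: I]) \esum_(j in [set: J]) a (i, j))%E.
Proof.
move=> a0; rewrite (esum_esum (a := fun i j => a (i, j)))//.
have -> : [set: I] `*`` (fun=> [set: J]) = [set: I * J].
  by apply/seteqP; split.
by apply: eq_esum => -[].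
Qed.

Lemma asummable_pair I J (a : I * J -> R) :
  (forall i, asummable (fun j => a (i, j))) ->
  asummable (fun i => asum (fun j => `|a (i, j)|)) -> asummable a.
Proof.
move=> sa saa; rewrite /asummable esum_pair; last by move=> k; rewrite lee_fin.
move: saa; rewrite /asummable; under eq_esum => i _.
  rewrite ger0_norm ?asum_ge0// EFin_asum//; last exact: asummable_norm (sa i).
  over.
by [].
Qed.

Lemma asummable_pairl I J (a : I * J -> R) : asummable a ->
  forall i, asummable (fun j => a (i, j)).
Proof.
move=> sa i; apply: le_lt_trans sa.
rewrite (esum_pair (a := fun k => `|a k|%:E)); last by move=> k; rewrite lee_fin.
rewrite [leRHS](esumID [set i]); last by move=> k _; apply: esum_ge0 => j _; rewrite lee_fin.
rewrite setTI esum_set1; last by apply: esum_ge0 => j _; rewrite lee_fin.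
rewrite leeDl//; apply: esum_ge0 => k _; apply: esum_ge0 => j _; by rewrite lee_fin.
Qed.

Lemma asummable_pair_asum I J (a : I * J -> R) : asummable a ->
  asummable (fun i => asum (fun j => a (i, j))).
Proof.
move=> sa; have sai := asummable_pairl sa.
apply: (@le_asummable _ (fun i => asum (fun j => `|a (i, j)|))).
  by move=> i; exact: ler_norm_asum.
rewrite /asummable; under eq_esum => i _.
  rewrite ger0_norm ?asum_ge0// EFin_asum//; last exact: asummable_norm (sai i).
  over.
by rewrite -(esum_pair (a := fun k => `|a k|%:E))// => k; rewrite lee_fin.
Qed.

Lemma asum_pair I J (a : I * J -> R) : asummable a ->
  asum a = asum (fun i => asum (fun j => a (i, j))).
Proof.
move=> sa; have sai := asummable_pairl sa.
have e (b : I * J -> R) : asummable b -> (forall k, 0 <= b k) ->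
    asum b = asum (fun i => asum (fun j => b (i, j))).
  move=> sb b0; rewrite !asum_ge0E//; last by move=> i; exact: asum_ge0.
  rewrite (esum_pair (a := fun k => (b k)%:E)); last by move=> k; rewrite lee_fin.
  congr fine; apply: eq_esum => i _; rewrite EFin_asum//.
  exact: (asummable_pairl sb).
have p0 (c : I * J -> R) i : 0 <= Num.max (c i) 0 by rewrite le_max lexx orbT.
have sp := asummable_pos sa; have sn := asummable_pos (asummableN sa).
rewrite (asumE sa) (e _ sp (p0 a)) (e _ sn (p0 (fun i => - a i))) -asumB;
  [|exact: (asummable_pair_asum sp)|exact: (asummable_pair_asum sn)].
apply: eq_asum => i; rewrite -asumB; [|exact: (asummable_pairl sp)|exact: (asummable_pairl sn)].
by apply: eq_asum => j; rewrite -max0_sub.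
Qed.

Lemma esum_swap I J (a : I * J -> \bar R) :
  (\esum_(k in [set: J * I]) a (k.2, k.1) = \esum_(k in [set: I * J]) a k)%E.
Proof.
rewrite (reindex_esum [set: J * I] [set: I * J] (fun k => (k.2, k.1)))//.
split=> //; first by move=> [? ?] [? ?] _ _ [-> ->].
by move=> [i j] _; exists (j, i).
Qed.

Lemma asum_exchange I J (a : I * J -> R) : asummable a ->
  asum (fun i => asum (fun j => a (i, j))) = asum (fun j => asum (fun i => a (i, j))).
Proof.
move=> sa; rewrite -(asum_pair sa).
have sa' : asummable (fun k : J * I => a (k.2, k.1)).
  by rewrite /asummable (esum_swap (fun k => `|a k|%:E)).
rewrite -(asum_pair sa') /asum.
by rewrite -(esum_swap (fun k => (Num.max (a k) 0)%:E)) -(esum_swap (fun k => (Num.max (- a k) 0)%:E)).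
Qed.

End AbsolutelySummable.

(** * Right derivatives *)

Section RightDerivative.
Context {R : realType}.
Implicit Types (phi psi : R -> R) (t D : R).

Definition is_right_derive phi t D : Prop :=
  (phi (t + h) - phi t) / h @[h --> 0^'+] --> D.

(** The backward equation yields one-sided derivatives, so a lower slope [- e] is propagated from
    [a] as far as possible: left continuity carries the bound to the supremum of the good times, the
    right derivative carries it beyond. Then [e] tends to 0. *)
Lemma right_derive_ge0_le phi (a b : R) : a <= b ->
  (forall t, a <= t -> t < b -> exists2 D, 0 <= D & is_right_derive phi t D) ->
  (forall t, a < t -> t <= b -> phi s @[s --> t^'-] --> phi t) ->
  phi a <= phi b.
Proof.
move=> ab rd lc.
suff H e : 0 < e -> phi a - e * (b - a) <= phi b.
  apply/ler_addgt0Pr => e e0.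
  have be : 0 < b - a + 1 by lra.
  have := H (e / (b - a + 1)) (divr_gt0 e0 be).
  have : e / (b - a + 1) * (b - a) <= e.
    by rewrite mulrAC ler_pdivrMr// ler_wpM2l//; lra.
  lra.
move=> e0; pose good t := a <= t <= b /\ forall s, a <= s <= t -> phi a - e * (s - a) <= phi s.
pose A := [set t | good t].
have Aa : A a.
  split; first by rewrite lexx.
  move=> s; rewrite -eq_le => /eqP <-; lra.
have supA : has_sup A.
  by split; [exists a|exists b => t [/andP[]]].
set c := sup A.
have ac : a <= c by exact: (sup_upper_bound supA).
have cb : c <= b by apply: ge_sup; [exists a|move=> t [/andP[]]].
have below s : a <= s -> s < c -> phi a - e * (s - a) <= phi s.
  move=> as_ sc; have cs0 : 0 < c - s by rewrite subr_gt0.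
  have [t [_ At] st] := sup_adherent cs0 supA.
  by apply: At; rewrite as_ /= ltW//; move: st; rewrite -/c; lra.
have atc : phi a - e * (c - a) <= phi c.
  have [->|can] := eqVneq c a; first lra.
  have ac' : a < c by rewrite lt_neqAle eq_sym can.
  have cv : phi s + e * (s - a) @[s --> c^'-] --> phi c + e * (c - a).
    apply: cvgD; first exact: lc.
    apply: cvgM; first exact: cvg_cst.
    apply: cvgB; last exact: cvg_cst.
    by apply: cvg_at_left_filter; exact: cvg_id.
  suff : phi a <= phi c + e * (c - a) by lra.
  apply: (cvgr_to_ge cv); near=> s.
  have : phi a - e * (s - a) <= phi s; last lra.
  apply: below; last by near: s; exact: nbhs_left_lt.
  by near: s; exact: nbhs_left_ge.
have Ac : A c.
  split; first by rewrite ac.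
  move=> s /andP[as_]; rewrite le_eqVlt => /predU1P[->//|]; exact: below.
have [cb'|bc] := ltP c b; last first.
  have <- : c = b by apply/eqP; rewrite eq_le cb.
  exact: atc.
have [D D0 cD] := rd _ ac cb'.
have /nbhs_ballP[d d0 dP] : \forall h \near 0^'+, - e < (phi (c + h) - phi c) / h.
  apply: cvgr_gt cD _ _; lra.
rewrite /= in d0.
(* A good time beyond [c] contradicts the supremum; [d / 2] keeps the new times strictly inside the
   ball of radius [d]. *)
suff : A (c + Num.min (d / 2) (b - c)).
  move=> /(sup_upper_bound supA); rewrite -/c.
  have : 0 < Num.min (d / 2) (b - c) by rewrite lt_min divr_gt0//= subr_gt0.
  lra.
have m1 : Num.min (d / 2) (b - c) <= d / 2 by rewrite ge_min lexx.
have m2 : Num.min (d / 2) (b - c) <= b - c by rewrite ge_min lexx orbT.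
have m0 : 0 < Num.min (d / 2) (b - c) by rewrite lt_min divr_gt0//= subr_gt0.
split; first by apply/andP; split; lra.
move=> s /andP[as_ sm]; have [sc|cs] := leP s c.
  by move: sc; rewrite le_eqVlt => /predU1P[->//|]; exact: below.
have sc0 : 0 < s - c by rewrite subr_gt0.
have /= := dP (s - c); rewrite /ball /= sub0r normrN gtr0_norm// => /(_ _ sc0).
have -> : c + (s - c) = s by lra.
rewrite ltr_pdivlMr// => /(_ _) H.
have : - e * (s - c) < phi s - phi c by apply: H; lra.
move: atc; lra.
Unshelve. all: by end_near. Qed.

End RightDerivative.

(** * Transition operators and the backward equation *)

Section TransitionOperator.
Context {R : realType} {S : countType}.
Variable p : R -> S -> S -> R.
Hypothesis p_tf : transition_function p.
Implicit Types (F : S -> R) (c : S) (s t h B : R).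

Lemma bounded_funP F : bounded_fun F <-> exists B, forall c, `|F c| <= B.
Proof.
split=> [[B [_ HB]]|[B HB]].
  by exists (B + 1) => c; apply: (HB (B + 1)) => //; rewrite ltrDl.
exists B; split=> [|M BM c _ /=]; first exact: num_real.
exact: le_trans (HB c) (ltW BM).
Qed.

Lemma transition_asummable t c : 0 <= t -> asummable (p t c).
Proof.
move=> t0; rewrite /asummable; under eq_esum do rewrite ger0_norm ?(transition_ge0 p_tf)//.
by rewrite (transition_total p_tf)// ltry.
Qed.

Lemma transition_mass t c : 0 <= t -> asum (p t c) = 1.
Proof.
move=> t0; rewrite asum_ge0E; last by move=> c'; rewrite (transition_ge0 p_tf).
by rewrite (transition_total p_tf).
Qed.

Lemma transition_mul_asummable t c F B : 0 <= t -> (forall c', `|F c'| <= B) ->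
  asummable (fun c' => p t c c' * F c').
Proof.
move=> t0 FB; apply: (@le_asummable _ _ (fun c' => B * p t c c')); last first.
  exact/asummableZ/transition_asummable.
move=> c'; have p0 := transition_ge0 p_tf c c' t0.
by rewrite normrM (ger0_norm p0) mulrC ler_wpM2r.
Qed.

Lemma transition_op_cst t B c : 0 <= t -> transition_op p t (fun=> B) c = B.
Proof.
move=> t0; rewrite /transition_op; under eq_asum do rewrite mulrC.
by rewrite asumZ ?transition_mass ?mulr1//; exact: transition_asummable.
Qed.

Lemma transition_opB t F1 F2 B1 B2 c : 0 <= t ->
  (forall c', `|F1 c'| <= B1) -> (forall c', `|F2 c'| <= B2) ->
  transition_op p t (fun c' => F1 c' - F2 c') c =
  transition_op p t F1 c - transition_op p t F2 c.
Proof.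
move=> t0 FB1 FB2; rewrite /transition_op; under eq_asum do rewrite mulrBr.
by apply: asumB; apply: transition_mul_asummable => //; eassumption.
Qed.

Lemma transition_op_bounded t F B c : 0 <= t -> (forall c', `|F c'| <= B) ->
  `|transition_op p t F c| <= B.
Proof.
move=> t0 FB; have sF := transition_mul_asummable c t0 FB.
apply: le_trans (ler_norm_asum sF) _; rewrite -[leRHS](transition_op_cst B c t0).
apply: ler_asum; first exact: asummable_norm.
  by apply: (@transition_mul_asummable _ _ _ `|B|).
move=> c'; have p0 := transition_ge0 p_tf c c' t0.
by rewrite normrM (ger0_norm p0) ler_wpM2l.
Qed.

Lemma transition_op0 F c : transition_op p 0 F c = F c.
Proof.
rewrite /transition_op (@asum_single _ _ _ c); first by rewrite (transition_zero p_tf) eqxx mul1r.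
by move=> c' cc'; rewrite (transition_zero p_tf) eq_sym (negPf cc') mul0r.
Qed.

Lemma transition_op_add s t F B c : 0 <= s -> 0 <= t -> (forall c', `|F c'| <= B) ->
  transition_op p (s + t) F c = transition_op p s (transition_op p t F) c.
Proof.
move=> s0 t0 FB; rewrite /transition_op.
pose a (k : S * S) := p s c k.1 * p t k.1 k.2 * F k.2.
have sa : asummable a.
  apply: asummable_pair => [e|].
    rewrite /a /=; under eq_fun do rewrite -mulrA.
    by apply/asummableZ/(@transition_mul_asummable _ _ _ B).
  apply: (@le_asummable _ _ (fun e => B * p s c e)); last first.
    exact/asummableZ/transition_asummable.
  move=> e; rewrite ger0_norm ?asum_ge0//.
  have p0 := transition_ge0 p_tf c e s0.
  rewrite /a /=; under eq_asum do rewrite -mulrA normrM (ger0_norm p0).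
  rewrite asumZ; last by apply: asummable_norm; exact: (@transition_mul_asummable _ _ _ B).
  rewrite mulrC ler_wpM2r// -[leRHS](transition_op_cst B e t0).
  apply: ler_asum; first by apply: asummable_norm; exact: (@transition_mul_asummable _ _ _ B).
    by apply: (@transition_mul_asummable _ _ _ `|B|).
  move=> c'; have q0 := transition_ge0 p_tf e c' t0.
  by rewrite normrM (ger0_norm q0) ler_wpM2l.
transitivity (asum (fun c' => asum (fun e => a (e, c')))).
  apply: eq_asum => c'; rewrite (transition_add p_tf)// /a /=.
  under [RHS]eq_asum do rewrite mulrC.
  rewrite asumZ 1?mulrC//; apply: (@le_asummable _ _ (p s c)); last exact: transition_asummable.
  move=> e; rewrite normrM !ger0_norm ?(transition_ge0 p_tf)//.
  (* An entry of a row of mass 1 is at most 1: it is the sum of the family that keeps this entry and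
     vanishes elsewhere. *)
  rewrite ler_piMr ?(transition_ge0 p_tf)// -(transition_mass e t0).
  have -> : p t e c' = asum (fun k => if k == c' then p t e c' else 0).
    by rewrite (@asum_single _ _ _ c') ?eqxx// => k /negPf ->.
  apply: ler_asum; last 1 first.
  - by move=> i; case: eqP => [->//|_]; rewrite (transition_ge0 p_tf).
  - by apply: (@asummable_single _ _ _ c') => i /negPf ->.
  - exact: transition_asummable.
rewrite -asum_exchange//; apply: eq_asum => e; rewrite /a /=.
under eq_asum do rewrite -mulrA.
by rewrite asumZ//; exact: (@transition_mul_asummable _ _ _ B).
Qed.

(** The mass that stays at [c] contributes nothing to the difference, the remaining mass at most
    [2 * B] per unit. The bound depends on [F] through [B] alone; left continuity needs this, since
    it applies the estimate to [transition_op p s F] with [s] varying. *)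
Lemma transition_op_dist h F B c : 0 <= h -> (forall c', `|F c'| <= B) ->
  `|transition_op p h F c - F c| <= 2 * B * (1 - p h c c).
Proof.
move=> h0 FB; have B0 : 0 <= B by rewrite (le_trans _ (FB c)).
have FcB c' : `|F c' - F c| <= 2 * B.
  by rewrite (le_trans (ler_normB _ _))// mulr_natl mulr2n lerD.
rewrite -[F c in X in X <= _](transition_op_cst (F c) c h0).
rewrite -(@transition_opB _ _ _ B `|F c|)//.
have sF : asummable (fun c' => p h c c' * (F c' - F c)).
  by apply: (@transition_mul_asummable _ _ _ (2 * B)).
apply: le_trans (ler_norm_asum sF) _.
have s1 : asummable (fun c' => p h c c' * (c == c')%:R).
  by apply: (@transition_mul_asummable _ _ _ 1) => // c'; case: (c == c'); rewrite ?normr1 ?normr0.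
have -> : 1 - p h c c = asum (fun c' => p h c c' - p h c c' * (c == c')%:R).
  rewrite asumB ?transition_mass//; last exact: transition_asummable.
  rewrite (@asum_single _ _ _ c) ?eqxx ?mulr1//.
  by move=> c'; rewrite eq_sym => /negPf ->; rewrite mulr0.
have sp := transition_asummable c h0.
rewrite -asumZ; last exact: asummableB.
apply: ler_asum; [exact: asummable_norm|exact/asummableZ/asummableB|].
move=> c'; have p0 := transition_ge0 p_tf c c' h0.
rewrite normrM (ger0_norm p0); have [->|_] := eqVneq c c'.
  by rewrite subrr normr0 mulr0 mulr1 subrr mulr0.
by rewrite mulr0 subr0 mulrC ler_wpM2r.
Qed.

Variable G : (S -> R) -> S -> R.
Hypothesis p_gen : has_generator p G.

(** The generator is tested on the indicator of [c]: the difference quotient of [p h c c] converges,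
    so its numerator tends to 0. *)
Lemma transition_diag_cvg c : p h c c @[h --> 0^'+] --> (1 : R).
Proof.
pose F c' : R := (c == c')%:R.
have bF : bounded_fun F.
  by apply/bounded_funP; exists 1 => c'; rewrite /F; case: (c == c'); rewrite ?normr1 ?normr0.
have PF h : transition_op p h F c = p h c c.
  rewrite /transition_op (@asum_single _ _ _ c) /F ?eqxx ?mulr1//.
  by move=> c'; rewrite eq_sym => /negPf ->; rewrite mulr0.
have h0 : (h : R) @[h --> 0^'+] --> (0 : R) by apply: cvg_at_right_filter; exact: cvg_id.
have H : (transition_op p h F c - F c) / h * h + (1 : R) @[h --> 0^'+] --> (1 : R).
  suff : (transition_op p h F c - F c) / h * h + 1 @[h --> 0^'+] --> G F c * 0 + 1.
    by rewrite mulr0 add0r.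
  by apply: cvgD; [apply: cvgM => //; exact: (@p_gen F bF c)|exact: cvg_cst].
apply: cvg_trans H; apply: near_eq_cvg; near=> h.
have hn0 : h != 0 by rewrite gt_eqF//; near: h; exact: nbhs_right_gt.
by rewrite PF /F eqxx /= divfK// subrK.
Unshelve. all: by end_near. Qed.

(* The backward equation: conditioning on the first h units of time turns the
   generator at time 0 into a right derivative at every time. *)
Lemma transition_op_right_derive F B c t : 0 <= t -> (forall c', `|F c'| <= B) ->
  is_right_derive (fun s => transition_op p s F c) t (G (transition_op p t F) c).
Proof.
move=> t0 FB; have bF : bounded_fun (transition_op p t F).
  by apply/bounded_funP; exists B => c'; exact: transition_op_bounded.
apply: cvg_trans (@p_gen _ bF c); apply: near_eq_cvg; near=> h.
have h0 : 0 <= h by apply: ltW; near: h; exact: nbhs_right_gt.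
by rewrite /= [t + h]addrC (@transition_op_add h t F B).
Unshelve. all: by end_near. Qed.

Lemma transition_op_left_cvg F B c t : 0 < t -> (forall c', `|F c'| <= B) ->
  transition_op p s F c @[s --> t^'-] --> transition_op p t F c.
Proof.
move=> t0 FB; have B0 : 0 <= B by rewrite (le_trans _ (FB c)).
apply/cvgrPdist_le => e e0.
have e'0 : 0 < e / (2 * B + 1) by rewrite divr_gt0//; lra.
have /cvgrPdist_le/(_ _ e'0)[d /= d0 dP] := transition_diag_cvg c.
near=> s.
have s0 : 0 <= s by near: s; apply: nbhs_left_ge.
have st : s < t by near: s; exact: nbhs_left_lt.
have tsd : t - s < d.
  have : t - d < s by near: s; apply: nbhs_left_gt; lra.
  lra.
have ts0 : 0 < t - s by lra.
have -> : t = (t - s) + s by lra.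
rewrite (@transition_op_add (t - s) s F B)//; last exact: ltW.
apply: le_trans (@transition_op_dist (t - s) _ B c (ltW ts0) _) _.
  by move=> c'; exact: transition_op_bounded.
have /= := dP (t - s); rewrite /ball /= sub0r normrN gtr0_norm// => /(_ tsd ts0) H.
have H1 : 1 - p (t - s) c c <= e / (2 * B + 1) by rewrite (le_trans (ler_norm _)).
apply: le_trans (ler_wpM2l _ H1) _; first lra.
by rewrite mulrA ler_pdivrMr ?mulrDr ?mulr1; nra.
Unshelve. all: by end_near. Qed.

End TransitionOperator.

(** * Calculus rules for right derivatives *)

Section RightDerivativeRules.
Context {R : realType}.
Implicit Types (phi psi : R -> R) (t D : R).

Lemma is_right_derive_cvg phi t D : is_right_derive phi t D ->
  phi (t + h) @[h --> 0^'+] --> phi t.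
Proof.
move=> rd; have h0 : (h : R) @[h --> 0^'+] --> (0 : R).
  by apply: cvg_at_right_filter; exact: cvg_id.
have H : (phi (t + h) - phi t) / h * h + phi t @[h --> 0^'+] --> phi t.
  suff : (phi (t + h) - phi t) / h * h + phi t @[h --> 0^'+] --> D * 0 + phi t.
    by rewrite mulr0 add0r.
  by apply: cvgD; [apply: cvgM|exact: cvg_cst].
apply: cvg_trans H; apply: near_eq_cvg; near=> h.
have hn0 : h != 0 by rewrite gt_eqF//; near: h; exact: nbhs_right_gt.
by rewrite /= divfK// subrK.
Unshelve. all: by end_near. Qed.

Lemma is_right_deriveM phi psi t D D' : is_right_derive phi t D ->
  is_right_derive psi t D' ->
  is_right_derive (fun s => phi s * psi s) t (phi t * D' + D * psi t).
Proof.
move=> rd rd'; rewrite /is_right_derive.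
have H : phi (t + h) * ((psi (t + h) - psi t) / h) + (phi (t + h) - phi t) / h * psi t
    @[h --> 0^'+] --> phi t * D' + D * psi t.
  apply: cvgD; apply: cvgM => //; last exact: cvg_cst.
  exact: is_right_derive_cvg rd.
apply: cvg_trans H; apply: near_eq_cvg; near=> h => /=; ring.
Unshelve. all: by end_near. Qed.

Lemma is_right_deriveB phi psi t D D' : is_right_derive phi t D ->
  is_right_derive psi t D' ->
  is_right_derive (fun s => phi s - psi s) t (D - D').
Proof.
move=> rd rd'; rewrite /is_right_derive.
have H : (phi (t + h) - phi t) / h - (psi (t + h) - psi t) / h
    @[h --> 0^'+] --> D - D' by apply: cvgB.
apply: cvg_trans H; apply: near_eq_cvg; near=> h => /=; ring.
Unshelve. all: by end_near. Qed.

Lemma is_derive_right phi t D : is_derive t (1 : R) phi D -> is_right_derive phi t D.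
Proof.
move=> [dphi <-]; have H := cvg_dnbhs_at_right dphi.
apply: cvg_trans H; apply: near_eq_cvg; near=> h.
by rewrite /= /GRing.scale /= mulr1 mulrC [h + t]addrC.
Unshelve. all: by end_near. Qed.

Lemma is_derive_left_cvg phi t D : is_derive t (1 : R) phi D ->
  phi s @[s --> t^'-] --> phi t.
Proof.
move=> [/derivable1_diffP/differentiable_continuous c _].
exact: cvg_at_left_filter.
Qed.

Lemma is_derive_expRM l t :
  is_derive t (1 : R) (fun s : R => expR (l * s)) (l * expR (l * t)).
Proof.
have dl : is_derive t (1 : R) (fun s : R => l * s) l.
  have H := is_deriveZ l (is_derive_id t (1 : R)).
  by apply: is_derive_eq H _; rewrite /GRing.scale /= mulr1.
have H := is_derive1_comp (is_derive_expR (l * t)) dl.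
by apply: is_derive_eq H _; rewrite mulrC.
Qed.

End RightDerivativeRules.

(** * Comparison with supersolutions of the backward equation *)

Section Comparison.
Context {R : realType} {S : countType}.
Variables (p : R -> S -> S -> R) (G : (S -> R) -> S -> R).
Hypotheses (p_tf : transition_function p) (p_gen : has_generator p G).
Variables (rho : S -> R) (K : R).
Implicit Types (F : S -> R) (c : S) (s t h B A : R).

Definition dominated F : Prop := exists A, forall c, `|F c| <= A * rho c.

Hypothesis rho_ge1 : forall c, 1 <= rho c.
Hypothesis G_cst : forall (a : R) c, G (fun=> a) c = 0.
Hypothesis G_linear : forall a F1 F2, dominated F1 -> dominated F2 ->
  forall c, G (fun c' => F1 c' + a * F2 c') c = G F1 c + a * G F2 c.
Hypothesis K_ge0 : 0 <= K.
(* Nonnegative jump rates, with total exit rate at most [K * rho c] out of c. *)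
Hypothesis G_ge0 : forall F, dominated F -> (forall c, 0 <= F c) ->
  forall c, - (K * rho c * F c) <= G F c.

Lemma bounded_dominated F B : (forall c, `|F c| <= B) -> dominated F.
Proof.
move=> FB; exists `|B| => c; apply: le_trans (FB c) _.
by rewrite (le_trans (ler_norm _))// ler_peMr.
Qed.

Lemma dominatedB F1 F2 : dominated F1 -> dominated F2 ->
  dominated (fun c => F1 c - F2 c).
Proof.
move=> [A1 H1] [A2 H2]; exists (A1 + A2) => c.
by rewrite (le_trans (ler_normB _ _))// mulrDl lerD.
Qed.

Let GB F1 F2 : dominated F1 -> dominated F2 ->
  forall c, G (fun c' => F1 c' - F2 c') c = G F1 c - G F2 c.
Proof.
move=> d1 d2 c; rewrite -[G F2 c]mul1r -mulNr -G_linear//.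
by under eq_fun do rewrite -[F2 _]mul1r -mulNr.
Qed.

Section Supersolution.
Variables (T N B A : R) (F : S -> R) (V V' : R -> S -> R).
Hypotheses (T_ge0 : 0 <= T) (FB : forall c, `|F c| <= B).
Hypothesis V_dom : forall t c, 0 <= t <= T -> `|V t c| <= A * rho c.
Hypothesis V_init : forall c, F c <= V 0 c.
Hypothesis V_far : forall t c, 0 <= t <= T -> N < rho c -> B <= V t c.
Hypothesis V_derive : forall t c, 0 <= t <= T -> is_derive t (1 : R) (V ^~ c) (V' t c).
Hypothesis V_super : forall t c, 0 <= t <= T -> G (V t) c <= V' t c.

Let u t c := transition_op p t F c.
Let w t c := V t c - u t c.
Let l := K * `|N|.

(* On {rho <= N} the exit rates are at most l, so exp (l t) (w t c + M) is
   nondecreasing in t whenever w >= - M everywhere. *)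
Lemma comparison_step (M : R) : 0 <= M ->
  (forall t c, 0 <= t <= T -> - M <= w t c) ->
  (forall t c, 0 <= t <= T -> - ((1 - expR (- (l * T))) * M) <= w t c).
Proof.
move=> M0 wM t c /andP[t0 tT].
have uB s c' : 0 <= s -> `|u s c'| <= B by move=> s0; exact: transition_op_bounded.
have l0 : 0 <= l by rewrite mulr_ge0.
have th : 0 <= 1 - expR (- (l * T)).
  by rewrite subr_ge0 -expR0 ler_expR oppr_le0 mulr_ge0.
(* Where [rho c > N], [V_far] gives [V >= B >= u], hence [w >= 0]. *)
have [cN|Nc] := leP (rho c) N; last first.
  apply: (@le_trans _ _ 0); first by rewrite oppr_le0 mulr_ge0.
  rewrite subr_ge0 (le_trans _ (V_far _ Nc)) ?t0//.
  by rewrite (le_trans (ler_norm _)) ?uB.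
pose phi s := expR (l * s) * (w s c + M).
have dE s : is_derive s (1 : R) (fun s : R => expR (l * s)) (l * expR (l * s)).
  exact: is_derive_expRM.
have dw s : 0 <= s -> s < T -> is_right_derive (fun s => w s c + M) s (V' s c - G (u s) c).
  move=> s0 sT; have H : is_right_derive (w ^~ c) s (V' s c - G (u s) c).
    apply: is_right_deriveB.
      by apply/is_derive_right/V_derive; rewrite s0 ltW.
    rewrite /u; apply: (@transition_op_right_derive _ _ _ p_tf _ p_gen F B) => //.
  apply: cvg_trans H; apply: near_eq_cvg; near=> h => /=; congr (_ / _); ring.
have : phi 0 <= phi t.
  apply: right_derive_ge0_le => //.
    move=> s s0 st; have sT : s < T := lt_le_trans st tT.
    have sI : 0 <= s <= T by rewrite s0 ltW.
    eexists; last exact: is_right_deriveM (is_derive_right (dE s)) (dw s s0 sT).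
    (* The bracket is nonnegative: [V' - G u >= G V - G u = G (w + M) >= - K rho (w + M) >= - l (w +
       M)]. Constants do not change [G], and [w + M >= 0] permits the use of [G_ge0]. *)
    rewrite /= (_ : _ + _ = expR (l * s) * ((V' s c - G (u s) c) + l * (w s c + M))); last by ring.
    rewrite mulr_ge0 ?expR_ge0//.
    have wM0 c' : 0 <= w s c' + M by rewrite -lerBlDr sub0r wM.
    have Vd : dominated (V s) by exists A => c'; exact: V_dom.
    have ud : dominated (u s) by apply: (@bounded_dominated _ B) => c'; exact: uB.
    have wd := dominatedB Vd ud.
    have Md : dominated (fun=> - M) by apply: (@bounded_dominated _ `|M|) => c'; rewrite normrN.
    have wMN c' : 0 <= w s c' - - M by rewrite opprK.
    have := G_ge0 (dominatedB wd Md) wMN c; rewrite (GB wd Md) G_cst subr0 (GB Vd ud) opprK.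
    have := V_super c sI.
    have : K * rho c * (w s c + M) <= l * (w s c + M).
      by rewrite ler_wpM2r// ler_wpM2l// (le_trans cN) ?ler_norm.
    rewrite -/(w s c); lra.
  move=> s s0 st; have sI : 0 <= s <= T by rewrite ltW//= (le_trans st).
  apply: cvgM; first exact: is_derive_left_cvg (dE s).
  apply: cvgD; last exact: cvg_cst.
  apply: cvgB; first exact: is_derive_left_cvg (V_derive c sI).
  by rewrite /u; apply: (@transition_op_left_cvg _ _ _ p_tf _ p_gen F B).
rewrite /phi mulr0 expR0 mul1r => H.
have w0 : 0 <= w 0 c by rewrite /w /u transition_op0// subr_ge0.
have {H} : M <= expR (l * t) * (w t c + M) by rewrite (le_trans _ H)// lerDr.
rewrite -ler_pdivrMl ?expR_gt0// -expRN => H.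
have : expR (- (l * T)) * M <= expR (- (l * t)) * M.
  by rewrite ler_wpM2r// ler_expR lerN2 ler_wpM2l.
lra.
Unshelve. all: by end_near. Qed.

(** The usual argument at a minimum point fails, as [w] need not attain its infimum over [S].
    Instead each application of [comparison_step] multiplies the deficit [M] by
    [th = 1 - expR (- (l * T)) < 1], uniformly in time and state, and iteration drives it to 0. *)
Lemma transition_op_comparison t c : 0 <= t <= T -> transition_op p t F c <= V t c.
Proof.
move=> tI; rewrite -subr_ge0 -/(u t c) -/(w t c).
(* The starting deficit: on [rho <= N] the two terms of [M] bound [V] and [u]; elsewhere
   [w >= 0]. *)
pose th := 1 - expR (- (l * T)); pose M := `|A| * `|N| + B.
have B0 : 0 <= B by rewrite (le_trans _ (FB c)).
have M0 : 0 <= M by rewrite addr_ge0 ?mulr_ge0.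
have l0 : 0 <= l by rewrite mulr_ge0.
have th0 : 0 <= th.
  by rewrite subr_ge0 -expR0 ler_expR oppr_le0 mulr_ge0.
have th1 : `|th| < 1 by rewrite ger0_norm// /th; have := expR_gt0 (- (l * T)); lra.
have wM s c' : 0 <= s <= T -> - M <= w s c'.
  move=> /[dup] sI /andP[s0 sT].
  have uB : `|u s c'| <= B by exact: transition_op_bounded.
  have uB' : u s c' <= B by rewrite (le_trans (ler_norm _)).
  have [cN|Nc] := leP (rho c') N; last first.
    apply: (@le_trans _ _ 0); first by rewrite oppr_le0.
    by rewrite subr_ge0 (le_trans _ (V_far sI Nc)).
  have H : `|V s c'| <= `|A| * `|N|.
    rewrite (le_trans (V_dom c' sI))// (le_trans (ler_norm _))// normrM ler_wpM2l//.
    by rewrite ger0_norm ?(le_trans _ (rho_ge1 c'))// (le_trans cN) ?ler_norm.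
  have : - V s c' <= `|A| * `|N| by rewrite (le_trans _ H)// -normrN ler_norm.
  by rewrite /w /M; lra.
have iter k : forall s c', 0 <= s <= T -> - (M * th ^+ k) <= w s c'.
  elim: k => [|k IH] s c' sI; first by rewrite expr0 mulr1 wM.
  rewrite exprS mulrCA; apply: comparison_step => //.
  by rewrite mulr_ge0 ?exprn_ge0.
have cv : - (M * th ^+ k) @[k --> \oo] --> (0 : R).
  by rewrite -[X in _ --> X]oppr0; apply: cvgN; exact: cvg_geometric.
apply: (cvgr_to_le cv); near=> k.
exact: iter.
Unshelve. all: by end_near. Qed.

End Supersolution.

Variable kappa : R.
Hypothesis kappa_ge0 : 0 <= kappa.
Hypothesis G_rho : forall c, G rho c <= kappa * rho c.

Section ApproximateSolution.
Variables (T A delta : R) (v v' : R -> S -> R).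
Hypotheses (T_ge0 : 0 <= T) (delta_ge0 : 0 <= delta).
Hypothesis v_dom : forall t c, 0 <= t <= T -> `|v t c| <= A * rho c.
Hypothesis v_far : forall e, 0 < e -> exists N, forall t c, 0 <= t <= T ->
  N < rho c -> `|v t c| <= e * rho c.
Hypothesis v_derive : forall t c, 0 <= t <= T -> is_derive t (1 : R) (v ^~ c) (v' t c).
Hypothesis v_approx : forall t c, 0 <= t <= T -> `|G (v t) c - v' t c| <= delta * rho c.

Let rho_ge0 c : 0 <= rho c. Proof. exact: le_trans (rho_ge1 c). Qed.

(** The supersolution is [v + b rho]. Its coefficient satisfies
    [b' = kappa b + delta expR (kappa t)]: the first term pays for [G rho <= kappa rho], the second
    for the defect of [v]. *)
Lemma transition_op_le_approx F B e t c : 0 < e -> (forall c', `|F c'| <= B) ->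
  (forall c', F c' <= v 0 c' + e * rho c') -> 0 <= t <= T ->
  transition_op p t F c <= v t c + (e + delta * t) * expR (kappa * t) * rho c.
Proof.
move=> e0 FB Fv tI; have B0 : 0 <= B by rewrite (le_trans _ (FB c)).
pose b t := (e + delta * t) * expR (kappa * t).
pose b' t := (e + delta * t) * (kappa * expR (kappa * t)) + delta * expR (kappa * t).
have exp1 s : 0 <= s -> 1 <= expR (kappa * s).
  by move=> s0; rewrite -expR0 ler_expR mulr_ge0.
have be s : 0 <= s -> e <= b s.
  move=> s0; rewrite -[leLHS]mulr1; apply: ler_pM; [exact: ltW|exact: ler01| |exact: exp1].
  by rewrite lerDl mulr_ge0.
have db s : is_derive s (1 : R) b (b' s).
  have d1 : is_derive s (1 : R) (fun s : R => e + delta * s) delta.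
    have H := is_deriveD (is_derive_cst e s (1 : R)) (is_deriveZ delta (is_derive_id s (1 : R))).
    by apply: is_derive_eq H _; rewrite /GRing.scale /= mulr1 add0r.
  have H := is_deriveM d1 (is_derive_expRM kappa s).
  by apply: is_derive_eq H _; rewrite /GRing.scale /= /b' [X in _ + X]mulrC.
(* Half of [e * rho] absorbs [v]; the other half exceeds [B] once [rho > 2 * B / e]. *)
have [N1 HN1] := v_far (divr_gt0 e0 (ltr0n _ 2)).
have rdom : dominated rho by exists 1 => c'; rewrite mul1r ger0_norm ?rho_ge0.
apply: (@transition_op_comparison T (Num.max N1 (2 * B / e)) B (A + b T) F
  (fun s c' => v s c' + b s * rho c') (fun s c' => v' s c' + b' s * rho c')) => //.
- move=> s c' /[dup] sI /andP[s0 sT]; rewrite (le_trans (ler_normD _ _))// mulrDl lerD ?v_dom//.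
  have b0 : 0 <= b s by rewrite (le_trans (ltW e0))// be.
  have r0 := rho_ge0 c'; rewrite (ger0_norm (mulr_ge0 b0 r0)); apply: ler_wpM2r => //.
  apply: ler_pM; rewrite ?expR_ge0//.
  + by rewrite addr_ge0 ?mulr_ge0// ltW.
  + by rewrite lerD2l ler_wpM2l.
  + by rewrite ler_expR ler_wpM2l.
- by move=> c'; rewrite /b !mulr0 expR0 addr0 mulr1.
- move=> s c' /[dup] sI /andP[s0 sT]; rewrite gt_max => /andP[c1 c2].
  have := HN1 s c' sI c1; rewrite ler_norml => /andP[h _].
  have : e * rho c' <= b s * rho c' by rewrite ler_wpM2r ?rho_ge0// be.
  have : 2 * B < rho c' * e by rewrite -ltr_pdivrMr.
  lra.
- move=> s c' sI; have H := is_deriveD (v_derive c' sI) (is_deriveM (db s) (is_derive_cst (rho c') s (1 : R))).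
  apply: is_derive_eq H _; by rewrite /GRing.scale /= mulr0 add0r [rho c' * _]mulrC.
- move=> s c' /[dup] sI /andP[s0 sT].
  rewrite G_linear//; last by exists A => c''; exact: v_dom.
  have := v_approx c' sI; rewrite ler_norml => /andP[_ h].
  have b0 : 0 <= b s by rewrite (le_trans (ltW e0))// be.
  have h1 := ler_wpM2l b0 (G_rho c').
  have h2 : delta * rho c' <= delta * expR (kappa * s) * rho c'.
    by rewrite ler_wpM2r ?rho_ge0// ler_peMr// exp1.
  rewrite /b' mulrDl; move: h1; rewrite /b; lra.
Qed.

End ApproximateSolution.

(** This is where integrability of [rho] is gained. A finite partial sum sees [rho] only below some
    level [m], so [rho] may be truncated there to a bounded [F], and the bound obtained for [F] does
    not involve [m]. *)
Lemma esum_transition_rho t c : 0 <= t ->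
  (\esum_(c' in [set: S]) (p t c c' * rho c')%:E <= (expR (kappa * t) * rho c)%:E)%E.
Proof.
move=> t0; have rho0 c' : 0 <= rho c' by exact: le_trans (rho_ge1 c').
apply: ge_ereal_sup => /= _ [X [finX _]] <-.
have [m Hm] : exists m, forall c', X c' -> rho c' <= m.
  exists (\sum_(c' \in X) rho c') => c' Xc'.
  rewrite (fsbigD1 c')//= lerDl fsumr_ge0// => ? _; exact: rho0.
pose F c' := if rho c' <= m then rho c' else 0.
have FB c' : `|F c'| <= `|m|.
  by rewrite /F; case: ifP => [h|_]; rewrite ?normr0// ger0_norm// (le_trans h) ?ler_norm.
have F0 c' : 0 <= F c' by rewrite /F; case: ifP.
have -> : (\sum_(c' \in X) (p t c c' * rho c')%:E = \sum_(c' \in X) (p t c c' * F c')%:E)%E.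
  by apply: eq_fsbigr => c'; rewrite inE => /Hm; rewrite /F => ->.
have sF := transition_mul_asummable p_tf c t0 FB.
have pF0 c' : 0 <= p t c c' * F c' by rewrite mulr_ge0 ?(transition_ge0 p_tf).
apply: (@le_trans _ _ (transition_op p t F c)%:E).
  by rewrite /transition_op EFin_asum//; apply: ereal_sup_ubound; exists X.
have G0 c' : G (fun=> 0) c' = 0 by exact: G_cst.
(* The right-hand side is brought to the form [0 + (1 + 0 * t) * ...], that of the comparison with
   [v = 0], [e = 1] and [delta = 0]. *)
rewrite lee_fin -[leRHS]mul1r mulrA -[X in _ <= X * _ * _]addr0 -[X in _ <= (_ + X) * _ * _](mul0r t).
rewrite -[leRHS]add0r.
apply: (@transition_op_le_approx t 0 0 (fun _ _ => 0) (fun _ _ => 0) _ _ _ _ _ _ F `|m|) => //.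
- by move=> *; rewrite normr0 mul0r.
- by move=> e e0; exists 0 => s c' _ _; rewrite normr0 mulr_ge0// ltW.
- by move=> s c' _; exact: is_derive_cst.
- by move=> s c' _ /=; rewrite G0 subr0 normr0 mul0r.
- by move=> c'; rewrite add0r mul1r /F; case: ifP.
- by rewrite t0 lexx.
Qed.

Lemma transition_mul_rho_asummable t c : 0 <= t ->
  asummable (fun c' => p t c c' * rho c').
Proof.
move=> t0; rewrite /asummable; under eq_esum do rewrite ger0_norm ?mulr_ge0
  ?(transition_ge0 p_tf)// ?(le_trans _ (rho_ge1 _))//.
exact: le_lt_trans (esum_transition_rho c t0) (ltry _).
Qed.

Lemma transition_op_rho_le t c : 0 <= t ->
  transition_op p t rho c <= expR (kappa * t) * rho c.
Proof.
move=> t0; rewrite -lee_fin /transition_op EFin_asum; first exact: esum_transition_rho.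
  by move=> c'; rewrite mulr_ge0 ?(transition_ge0 p_tf)// (le_trans _ (rho_ge1 _)).
exact: transition_mul_rho_asummable.
Qed.

Lemma transition_mul_dominated_asummable F t c : dominated F -> 0 <= t ->
  asummable (fun c' => p t c c' * F c').
Proof.
move=> [A FA] t0; apply: (@le_asummable _ _ (fun c' => A * (p t c c' * rho c'))).
  move=> c'; have p0 := transition_ge0 p_tf c c' t0.
  by rewrite normrM (ger0_norm p0) mulrCA ler_wpM2l.
exact/asummableZ/transition_mul_rho_asummable.
Qed.

Lemma transition_op_approx (T A delta : R) (v v' : R -> S -> R) t c :
  0 <= T -> 0 <= delta ->
  (forall t c, 0 <= t <= T -> `|v t c| <= A * rho c) ->
  (forall e, 0 < e -> exists N, forall t c, 0 <= t <= T ->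
     N < rho c -> `|v t c| <= e * rho c) ->
  (forall t c, 0 <= t <= T -> is_derive t (1 : R) (v ^~ c) (v' t c)) ->
  (forall t c, 0 <= t <= T -> `|G (v t) c - v' t c| <= delta * rho c) ->
  0 <= t <= T ->
  transition_op p t (v 0) c - v t c <= delta * t * expR (kappa * t) * rho c.
Proof.
move=> T0 de0 vA vfar vd va /[dup] tI /andP[t0 tT].
have zI : 0 <= (0 : R) <= T by rewrite lexx.
have rho0 c' : 0 <= rho c' by exact: le_trans (rho_ge1 c').
have X0 : 0 <= expR (kappa * t) * rho c by rewrite mulr_ge0 ?expR_ge0.
set X := expR (kappa * t) * rho c in X0 *.
(* One [e] pays for comparing the truncated initial datum with [v 0], the other for the discarded
   tail after time [t]. *)
suff H e : 0 < e -> transition_op p t (v 0) c - v t c <= (2 * e + delta * t) * X.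
  apply/ler_addgt0Pr => e e0; have X1 : 0 < 2 * (X + 1) by lra.
  have := H (e / (2 * (X + 1))) (divr_gt0 e0 X1).
  have : 2 * (e / (2 * (X + 1))) * X <= e.
    rewrite (_ : _ * _ = e * X / (X + 1)); last by field; lra.
    by rewrite ler_pdivrMr ?mulrDr ?mulr1; lra.
  rewrite mulrDl -[delta * t * _ * _]mulrA -/X; lra.
move=> e0; have [N HN] := vfar e e0.
pose F c' := if rho c' <= N then v 0 c' else 0.
have FB c' : `|F c'| <= `|A| * `|N|.
  rewrite /F; case: ifP => [h|_]; last by rewrite normr0 mulr_ge0.
  apply: le_trans (vA _ c' zI) _; apply: le_trans (ler_norm _) _; rewrite normrM.
  by rewrite ler_wpM2l// (ger0_norm (rho0 c')) (le_trans h) ?ler_norm.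
have Fv c' : `|v 0 c' - F c'| <= e * rho c'.
  rewrite /F; case: ifPn => [h|]; first by rewrite subrr normr0 mulr_ge0// ltW.
  by rewrite subr0 -ltNge => h; exact: HN.
have h1 : transition_op p t F c <= v t c + (e + delta * t) * expR (kappa * t) * rho c.
  apply: (transition_op_le_approx T0 de0 vA vfar vd va c e0 FB _ tI) => c'.
  by have := Fv c'; rewrite ler_norml => /andP[]; lra.
have sv : asummable (fun c' => p t c c' * v 0 c').
  by apply: transition_mul_dominated_asummable => //; exists A => c'; exact: vA.
have sF := transition_mul_asummable p_tf c t0 FB.
have h2 : transition_op p t (v 0) c - transition_op p t F c <= e * X.
  rewrite -asumB//; apply: (@le_trans _ _ (e * transition_op p t rho c)).
    rewrite -asumZ; last exact: transition_mul_rho_asummable.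
    apply: ler_asum; first exact: asummableB.
      exact/asummableZ/transition_mul_rho_asummable.
    move=> c'; rewrite -mulrBr mulrCA ler_wpM2l ?(transition_ge0 p_tf)//.
    exact: le_trans (ler_norm _) (Fv c').
  by rewrite ler_wpM2l ?transition_op_rho_le// ltW.
move: h1; rewrite -[_ * _ * rho c]mulrA -/X; lra.
Qed.

(** The hypotheses are invariant under [v -> - v], so the one-sided estimate applied to [- v]
    supplies the lower bound. *)
Lemma transition_op_approx_norm (T A delta : R) (v v' : R -> S -> R) t c :
  0 <= T -> 0 <= delta ->
  (forall t c, 0 <= t <= T -> `|v t c| <= A * rho c) ->
  (forall e, 0 < e -> exists N, forall t c, 0 <= t <= T ->
     N < rho c -> `|v t c| <= e * rho c) ->
  (forall t c, 0 <= t <= T -> is_derive t (1 : R) (v ^~ c) (v' t c)) ->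
  (forall t c, 0 <= t <= T -> `|G (v t) c - v' t c| <= delta * rho c) ->
  0 <= t <= T ->
  `|transition_op p t (v 0) c - v t c| <= delta * t * expR (kappa * t) * rho c.
Proof.
move=> T0 de0 vA vfar vd va /[dup] tI /andP[t0 tT].
have zI : 0 <= (0 : R) <= T by rewrite lexx.
rewrite ler_norml lerNl; apply/andP; split; last exact: (transition_op_approx c T0 de0 vA vfar vd va).
have sv : asummable (fun c' => p t c c' * v 0 c').
  by apply: transition_mul_dominated_asummable => //; exists A => c'; exact: vA.
have -> : - (transition_op p t (v 0) c - v t c) =
    transition_op p t (fun c' => - v 0 c') c - (- v t c).
  rewrite /transition_op; under [in RHS]eq_asum do rewrite mulrN.
  by rewrite asumN// opprB addrC opprK.
apply: (@transition_op_approx T A delta (fun t c => - v t c) (fun t c => - v' t c)) => //.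
- by move=> s c' sI; rewrite normrN; exact: vA.
- by move=> e e0; have [N HN] := vfar e e0; exists N => s c' sI Nc; rewrite normrN; exact: HN.
- by move=> s c' sI; have := vd s c' sI => ?; exact: is_deriveN.
- move=> s c' sI; have vdom : dominated (v s) by exists A => c''; exact: vA.
  have d0 : dominated (fun=> 0) by apply: (@bounded_dominated 0) => c''; rewrite normr0.
  have -> : (fun c => - v s c) = (fun c => 0 - v s c) by apply/funext => c''; rewrite sub0r.
  by rewrite GB// G_cst sub0r -opprD normrN; exact: va.
Qed.

End Comparison.

(** * Expectation of a function of a countable-valued variable *)

Section CountableExpectation.
Context {R : realType} {S : countType} {d : measure_display} {Omega : measurableType d}.
Variables (P : probability Omega R) (X : Omega -> S) (q : S -> R).
Hypothesis mX : forall c, measurable (X @^-1` [set c]).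
Hypothesis PX : forall c, P (X @^-1` [set c]) = (q c)%:E.

Lemma measurable_preimage_countable (B : set S) : measurable (X @^-1` B).
Proof.
have -> : X @^-1` B = \bigcup_k
    (if @choice.unpickle S k is Some c then (if c \in B then X @^-1` [set c] else set0) else set0).
  apply/seteqP; split=> [w Bw|w [k _]].
    by exists (choice.pickle (X w)) => //; rewrite choice.pickleK mem_set.
  by case: (choice.unpickle k) => // c; case: ifP => // /set_mem Bc /= ->.
apply: bigcup_measurable => k _; case: (choice.unpickle k) => // c.
by case: ifP.
Qed.

Lemma ge0_integral_countable (h : S -> R) : (forall c, 0 <= h c) ->
  (\int[P]_w (h (X w))%:E = \esum_(c in [set: S]) (q c * h c)%:E)%E.
Proof.
(* The events [X = c] are indexed by the codes of the states, to fit countable additivity over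
   [nat]; integers that code no state give the empty event. *)
move=> h0; pose F k := X @^-1` [set c | choice.pickle c = k].
have FT : \bigcup_k F k = setT.
  by apply/seteqP; split=> // w _; exists (choice.pickle (X w)).
have mh : measurable_fun [set: Omega] (fun w => (h (X w))%:E : \bar R).
  move=> _ B mB; rewrite setTI.
  exact: (measurable_preimage_countable [set c | B (h c)%:E]).
rewrite -FT ge0_integral_bigcup//=; last 4 first.
- by move=> k; exact: measurable_preimage_countable.
- by rewrite FT.
- by move=> w _; rewrite lee_fin.
- by apply/trivIsetP => i j _ _ ij; apply/seteqP; split=> // w [/= wi wj]; move: ij; rewrite -wi -wj eqxx.
rewrite nneseries_esumT; last by move=> k; apply: integral_ge0 => w _; rewrite lee_fin.
rewrite (esumID (range (@choice.pickle S))); last by move=> k _; apply: integral_ge0 => w _; rewrite lee_fin.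
rewrite [X in (_ + X)%E]esum1 ?adde0; last first.
  move=> k [_ nk]; rewrite (_ : F k = set0) ?integral_set0//.
  by apply/seteqP; split=> // w /= wk; apply: nk; exists (X w).
rewrite setTI esum_image; last by move=> x y _ _; exact: (pcan_inj choice.pickleK).
apply: eq_esum => c _.
have -> : F (choice.pickle c) = X @^-1` [set c].
  by apply/seteqP; split=> w /=; [exact: (pcan_inj choice.pickleK)|rewrite /F /= => ->].
rewrite (eq_integral (fun=> (h c)%:E)); last by move=> w; rewrite inE /= => ->.
rewrite integral_cst; last exact: mX.
by rewrite mulrC EFinM; congr (_ * _)%E; exact: PX.
Qed.

Lemma expectation_countable (g : S -> R) : asummable (fun c => q c * g c) ->
  ('E_P[fun w => g (X w)] = (asum (fun c => q c * g c))%:E)%E.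
Proof.
move=> sg; rewrite unlock integralE.
have q0 c : 0 <= q c by rewrite -lee_fin -PX.
have e (h : S -> R) : (\int[P]_w (Num.max (h (X w)) 0)%:E =
    \esum_(c in [set: S]) (Num.max (q c * h c) 0)%:E)%E.
  rewrite (ge0_integral_countable (h := fun c => Num.max (h c) 0)); last first.
    by move=> c; rewrite le_max lexx orbT.
  apply: eq_esum => c _; congr EFin.
  by rewrite maxr_pMr// mulr0.
rewrite (_ : (fun w => (g (X w))%:E)^\+ = (fun w => (Num.max (g (X w)) 0)%:E))%E; last first.
  by apply/funext => w; rewrite funeposE EFin_max.
rewrite (_ : (fun w => (g (X w))%:E)^\- = (fun w => (Num.max (- g (X w)) 0)%:E))%E; last first.
  by apply/funext => w; rewrite funenegE EFin_max.
rewrite e (e (fun c => - g c)) /asum.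
have -> : (fun c => (Num.max (q c * - g c) 0)%:E) = (fun c => (Num.max (- (q c * g c)) 0)%:E).
  by apply/funext => c; rewrite mulrN.
have p0 (a : S -> R) c : 0 <= Num.max (a c) 0 by rewrite le_max lexx orbT.
have s1 := esum_ge0_fin (p0 _) (asummable_pos sg).
have s2 := esum_ge0_fin (p0 _) (asummable_pos (asummableN sg)).
by rewrite fineK// fin_numB s1.
Qed.

End CountableExpectation.

(** * The generator of the particle system *)

Section MultisetSums.
Context {R : realType} {E : countType}.
Implicit Types (A : {mset E}%mset) (h : E -> R) (x y : E).

Lemma sum_msetD A A' h :
  \sum_(z <- (A `+` A')%mset) h z = \sum_(z <- A) h z + \sum_(z <- A') h z.
Proof.
rewrite -big_cat; apply: perm_big; apply/allP => z _ /=.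
by rewrite count_cat !count_mem_mset msetE2.
Qed.

Lemma sum_mset1 x h : \sum_(z <- [mset x]%mset) h z = h x.
Proof. by rewrite enum_msetn /= big_seq1. Qed.

Lemma sum_mset0 h : \sum_(z <- (mset0 : {mset E}%mset)) h z = 0.
Proof. by rewrite enum_mset0 big_nil. Qed.

(** Since [x] is in [A], the truncated subtraction can be undone by adding [x] back. *)
Lemma sum_mset_move A x y h : x \in A ->
  \sum_(z <- ((A `+` [mset y]) `\` [mset x])%mset) h z =
  \sum_(z <- A) h z + (h y - h x).
Proof.
move=> xA; have xAy : x \in (A `+` [mset y])%mset by rewrite in_msetD xA.
have := sum_msetD [mset x]%mset ((A `+` [mset y]) `\` [mset x])%mset h.
rewrite msetB1K// sum_msetD !sum_mset1; lra.
Qed.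

Lemma mset_natr A x : (A x)%:R = \sum_(u <- A) (u == x)%:R :> R.
Proof.
rewrite -count_mem_mset -sum1_count natr_sum big_mkcond /=.
by apply: eq_bigr => u _ /=; case: (u == x).
Qed.

Lemma fsum_mset A h : \sum_(x \in [set: E]) (A x)%:R * h x = \sum_(z <- A) h z.
Proof.
have -> : \sum_(x \in [set: E]) (A x)%:R * h x = \sum_(x \in [set` finsupp A]) (A x)%:R * h x.
  apply/esym/fsbig_widen => // x [_ /= /negP]; rewrite memNfinsupp => /eqP ->.
  by rewrite mul0r.
rewrite big_mset [RHS]fsbig_seq ?fset_uniq//; apply: eq_fsbigr => x _.
by rewrite Monoid.iteropE iter_addr_0 mulr_natl.
Qed.

End MultisetSums.

(** * Sums over the transitions of a single mechanism *)

Section Flow.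
Context {R : realType} {E : countType} {S : Type}.
Variables (s : E -> E -> R) (A : {mset E}%mset) (T : E * E -> S) (c : S).
Hypothesis s_ge0 : forall x y, 0 <= s x y.
Hypothesis s_sum : forall x, asummable (s x).

Let fam (F : S -> R) (z : E * E) := s z.1 z.2 * (A z.1)%:R * (F (T z) - F c).

(** The multiplicity [A z.1] is a sum of indicators over the individual particles [u] of [A].
    Summing over pairs of sites thus becomes a finite sum over particles, each contributing one row
    of [a]. *)
Lemma asum_mset_weight (a : E * E -> R) : (forall x, asummable (fun y => a (x, y))) ->
  asummable (fun z => a z * (A z.1)%:R) /\
  asum (fun z => a z * (A z.1)%:R) = \sum_(x <- A) asum (fun y => a (x, y)).
Proof.
move=> sa; pose g u z : R := a z * (u == z.1)%:R.
have sg u : asummable (g u).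
  apply: asummable_pair => [x|].
    by rewrite /g /=; under eq_fun do rewrite mulrC; exact: asummableZ.
  apply: (@asummable_single _ _ _ u) => x /negPf xu; rewrite /g /= eq_sym xu.
  by under eq_asum do rewrite mulr0 normr0; exact: asum0.
have -> : (fun z => a z * (A z.1)%:R) = (fun z => \sum_(u <- A) g u z).
  by apply/funext => z; rewrite mset_natr mulr_sumr.
split; first exact: asummable_sum.
rewrite asum_sum//; apply: eq_bigr => u _; rewrite asum_pair// (@asum_single _ _ _ u).
  by rewrite /g /= eqxx; apply: eq_asum => y; rewrite mulr1.
move=> x /negPf xu; rewrite /g /= eq_sym xu.
by under eq_asum do rewrite mulr0; exact: asum0.
Qed.

(** The factor [A z.1] vanishes at empty sites, so the increment of [F] need be known only at
    occupied ones, where the truncated subtraction in the targets is exact. *)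
Lemma flowE (F : S -> R) (phi : E * E -> R) :
  (forall z, z.1 \in A -> F (T z) - F c = phi z) ->
  (forall x, asummable (fun y => s x y * phi (x, y))) ->
  asummable (fam F) /\
  asum (fam F) = \sum_(x <- A) asum (fun y => s x y * phi (x, y)).
Proof.
move=> Fphi sphi.
have -> : fam F = (fun z => s z.1 z.2 * phi z * (A z.1)%:R).
  apply/funext => z; rewrite /fam; have [zA|/mset_eq0P ->] := boolP (z.1 \in A).
    by rewrite Fphi// mulrAC.
  by rewrite !mulr0 mul0r.
exact: (asum_mset_weight (a := fun z => s z.1 z.2 * phi z)).
Qed.

Lemma flow_asummable (F : S -> R) (D : R) :
  (forall z, z.1 \in A -> `|F (T z) - F c| <= D) -> asummable (fam F).
Proof.
move=> FD; have sD x : asummable (fun y => s x y * D).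
  by under eq_fun do rewrite mulrC; exact: asummableZ.
have [sw _] := asum_mset_weight (a := fun z => s z.1 z.2 * D) sD.
apply: le_asummable sw => z; rewrite /fam.
have [zA|/mset_eq0P ->] := boolP (z.1 \in A); last by rewrite !mulr0 mul0r normr0.
by rewrite mulrAC !normrM (ger0_norm (s_ge0 _ _)) (ger0_norm (ler0n _ _)) ler_wpM2r// ler_wpM2l// FD.
Qed.

(** Dropping the nonnegative values [F (T z)] leaves minus the exit rate times [F c]. *)
Lemma flow_ge (F : S -> R) (D : R) :
  (forall z, z.1 \in A -> `|F (T z) - F c| <= D) -> (forall e, 0 <= F e) ->
  - ((\sum_(x <- A) asum (s x)) * F c) <= asum (fam F).
Proof.
move=> FD F0; have sF := flow_asummable FD.
have sD x : asummable (fun y => s x y * - F c).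
  by under eq_fun do rewrite mulrC; exact: asummableZ.
have [sw ew] := asum_mset_weight (a := fun z => s z.1 z.2 * - F c) sD.
have -> : - ((\sum_(x <- A) asum (s x)) * F c) = asum (fun z => s z.1 z.2 * - F c * (A z.1)%:R).
  rewrite ew -mulrN mulr_suml; apply: eq_bigr => x _.
  by rewrite mulrC -asumZ//; apply: eq_asum => y; rewrite mulrC.
apply: ler_asum => // z; rewrite /fam mulrAC ler_wpM2l ?mulr_ge0//.
by rewrite lerDr.
Qed.

End Flow.

Section BranchingGenerator.
Context {R : realType} {E : countType}.
Variables (r : E -> E -> R) (K : R).
Hypothesis r_sum : forall x, asummable (r x).
Hypothesis r_le : forall x, asum (fun y => `|r x y|) <= K.
Hypothesis K_ge0 : 0 <= K.
Implicit Types (F : config E -> R) (c : config E) (g : E -> R).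

(** Two Booleans index the four mechanisms, so that each estimate is proved once: [a] tells whether
    a particle or an antiparticle acts, [b] whether it jumps (rate [rpos]) or branches (rate
    [rneg]). *)
Definition rate (b : bool) : E -> E -> R := if b then rpos r else rneg r.
Definition source (a : bool) c : {mset E}%mset := if a then c.1 else c.2.
Definition target (a b : bool) c (z : E * E) : config E :=
  match a, b with
  | true, true => ((c.1 `+` [mset z.2]) `\` [mset z.1], c.2)%mset
  | true, false => (c.1 `+` [mset z.1], c.2 `+` [mset z.2])%mset
  | false, true => (c.1, (c.2 `+` [mset z.2]) `\` [mset z.1])%mset
  | false, false => (c.1 `+` [mset z.2], c.2 `+` [mset z.1])%mset
  end.
Definition flow a b F c : R :=
  asum (fun z => rate b z.1 z.2 * (source a c z.1)%:R * (F (target a b c z) - F c)).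

Lemma gen_upE F c : gen_up r F c =
  flow true true F c + flow true false F c + (flow false true F c + flow false false F c).
Proof.
by rewrite /gen_up /gen_up_plus /gen_up_minus /flow; congr (_ + _ + (_ + _));
  apply: eq_asum => -[x y].
Qed.

Lemma rate_ge0 b x y : 0 <= rate b x y.
Proof. by case: b; rewrite /rate /rpos /rneg le_max lexx orbT. Qed.

Lemma rate_sum b x : asummable (rate b x).
Proof.
apply: (@le_asummable _ _ (fun y => `|r x y|)); last exact: asummable_norm.
move=> y; rewrite ger0_norm ?rate_ge0//; case: b; rewrite /rate /rpos /rneg ge_max normr_ge0 andbT.
  exact: ler_norm.
by rewrite -normrN ler_norm.
Qed.

Definition population c : R := \sum_(z <- c.1) 1 + \sum_(z <- c.2) 1.
Definition weight c : R := (population c + 1) ^+ 2.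

Lemma population_ge0 c : 0 <= population c.
Proof. by rewrite addr_ge0// sumr_ge0. Qed.

Lemma weight_ge1 c : 1 <= weight c.
Proof. rewrite /weight; have := population_ge0 c; nra. Qed.

Lemma population_target a b c z : z.1 \in source a c ->
  population (target a b c z) = population c + (if b then 0 else 2).
Proof.
case: z a b => x y [] [] /= xA; rewrite /population /= ?sum_msetD ?sum_mset1 ?sum_mset_move//; ring.
Qed.

Lemma rateD x y : rate true x y + rate false x y = `|r x y|.
Proof.
rewrite /rate /rpos /rneg; have [h|] := boolP (0 <= r x y).
  by rewrite (max_l h) max_r ?addr0 ?ger0_norm// oppr_le0.
by rewrite -ltNge => h; rewrite (max_r (ltW h)) max_l ?add0r ?ltr0_norm// oppr_ge0 ltW.
Qed.

Lemma rateB x y : rate true x y - rate false x y = r x y.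
Proof. by rewrite /rate /rpos /rneg -max0_sub. Qed.

Lemma exit_rate_le c :
  (\sum_(x <- c.1) asum (rate true x) + \sum_(x <- c.1) asum (rate false x)) +
  (\sum_(x <- c.2) asum (rate true x) + \sum_(x <- c.2) asum (rate false x))
  <= K * population c.
Proof.
have H (A : {mset E}%mset) :
    \sum_(x <- A) asum (rate true x) + \sum_(x <- A) asum (rate false x) <= K * \sum_(x <- A) 1.
  rewrite -big_split mulr_sumr; apply: ler_sum => x _.
  rewrite mulr1; apply: le_trans (r_le x); under [leRHS]eq_asum do rewrite -rateD.
  by rewrite asumD//; exact: rate_sum.
by rewrite mulrDr lerD.
Qed.

Lemma dominated_target F c : dominated weight F ->
  exists D, forall a b z, z.1 \in source a c -> `|F (target a b c z) - F c| <= D.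
Proof.
move=> [A FA]; have A0 : 0 <= A.
  have := le_trans (normr_ge0 _) (FA c); rewrite pmulr_lge0//.
  exact: lt_le_trans (weight_ge1 c).
(* A transition raises the population by at most 2, and [weight] adds 1 before squaring. *)
exists (A * (population c + 3) ^+ 2 + A * weight c) => a b z zA.
rewrite (le_trans (ler_normB _ _))// lerD// (le_trans (FA _))// ler_wpM2l//.
rewrite /weight population_target//; have := population_ge0 c; case: b; nra.
Qed.

Lemma flow_family_asummable a b F c : dominated weight F ->
  asummable (fun z => rate b z.1 z.2 * (source a c z.1)%:R * (F (target a b c z) - F c)).
Proof.
move=> dF; have [D FD] := dominated_target c dF.
by apply: (flow_asummable (rate_ge0 b) (rate_sum b) (D := D)) => z; exact: FD.
Qed.

Lemma gen_up_cst (k : R) c : gen_up r (fun=> k) c = 0.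
Proof.
have H a b : flow a b (fun=> k) c = 0.
  by rewrite -[RHS](asum0 (E * E)%type); apply: eq_asum => z; rewrite subrr mulr0.
by rewrite gen_upE !H !addr0.
Qed.

Lemma gen_up_linear k F1 F2 : dominated weight F1 -> dominated weight F2 ->
  forall c, gen_up r (fun c' => F1 c' + k * F2 c') c = gen_up r F1 c + k * gen_up r F2 c.
Proof.
move=> d1 d2 c; rewrite !gen_upE.
have H a b : flow a b (fun c' => F1 c' + k * F2 c') c = flow a b F1 c + k * flow a b F2 c.
  have s1 := flow_family_asummable a b c d1; have s2 := flow_family_asummable a b c d2.
  rewrite /flow -asumZ// -asumD//; last exact: asummableZ.
  by apply: eq_asum => z; ring.
rewrite !H; ring.
Qed.

(** The total exit rate is at most [K * population c], and the population is at most the weight. *)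
Lemma gen_up_ge0 F : dominated weight F -> (forall c, 0 <= F c) ->
  forall c, - (K * weight c * F c) <= gen_up r F c.
Proof.
move=> dF F0 c; have [D FD] := dominated_target c dF.
have H a b : - ((\sum_(x <- source a c) asum (rate b x)) * F c) <= flow a b F c.
  by apply: (flow_ge (rate_ge0 b) (rate_sum b) (D := D)) => // z; exact: FD.
have := H true true; have := H true false; have := H false true; have := H false false.
rewrite gen_upE /=.
have := ler_wpM2r (F0 c) (exit_rate_le c).
have : K * population c * F c <= K * weight c * F c.
  rewrite ler_wpM2r// ler_wpM2l// /weight; have := population_ge0 c; nra.
lra.
Qed.

Lemma gen_up_weight_le c : gen_up r weight c <= 4 * K * weight c.
Proof.
(* With n the population, a branching raises the weight by (n+3)^2 - (n+1)^2 = 4(n+2), while a jump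
   leaves it unchanged. The total rate is at most K n, and n(n+2) <= (n+1)^2 yields the constant
   [4 * K]. *)
pose D := 4 * (population c + 2).
have D0 : 0 <= D by rewrite mulr_ge0// addr_ge0// population_ge0.
have H a b : flow a b weight c =
    \sum_(x <- source a c) asum (fun y => rate b x y * (if b then 0 else D)).
  apply: (proj2 (flowE (phi := fun=> if b then 0 else D) _ _)).
    move=> z zA; rewrite /weight population_target// /D; case: b; ring.
  by move=> x; under eq_fun do rewrite mulrC; apply/asummableZ/rate_sum.
have H1 a : flow a true weight c = 0.
  by rewrite H big1// => x _; under eq_asum do rewrite mulr0; exact: asum0.
have H2 a : flow a false weight c = (\sum_(x <- source a c) asum (rate false x)) * D.
  rewrite H mulr_suml; apply: eq_bigr => x _.
  by under eq_asum do rewrite mulrC; rewrite asumZ 1?mulrC//; exact: rate_sum.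
have p0 (A : {mset E}%mset) : 0 <= \sum_(x <- A) asum (rate true x).
  by apply: sumr_ge0 => x _; apply: asum_ge0 => y; exact: rate_ge0.
rewrite gen_upE !H1 !H2 /= !add0r -mulrDl.
apply: (@le_trans _ _ (K * population c * D)).
  rewrite ler_wpM2r//; have := exit_rate_le c; have := p0 c.1; have := p0 c.2; lra.
rewrite /D /weight; have := mulr_ge0 K_ge0 (population_ge0 c); have := K_ge0; nra.
Qed.

Lemma lift_upE g c : lift_up g c = \sum_(z <- c.1) g z - \sum_(z <- c.2) g z.
Proof.
(* Both supports lie in one finite set, on which the sum of a difference can be split; [g] itself
   may have infinite support. *)
pose X := (finsupp c.1 `|` finsupp c.2)%fset.
have W (k : E -> R) : (forall x, x \notin X -> k x = 0) ->
    \sum_(x \in [set: E]) k x = \sum_(x \in [set` X]) k x.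
  by move=> k0; apply/esym/fsbig_widen => // x [_ /= /negP]; exact: k0.
rewrite /lift_up W; last first.
  move=> x /=; rewrite inE negb_or !memNfinsupp => /andP[/eqP cx1 /eqP cx2]; rewrite cx1 cx2.
  by rewrite subrr mul0r.
under eq_fsbigr do rewrite mulrBl -mulrN.
rewrite fsbig_split//= -!W.
- by rewrite !fsum_mset sumrN.
- by move=> x /=; rewrite inE negb_or !memNfinsupp => /andP[/eqP cx1 /eqP cx2]; rewrite ?cx1 ?cx2 mul0r.
- by move=> x /=; rewrite inE negb_or !memNfinsupp => /andP[/eqP cx1 /eqP cx2]; rewrite ?cx1 ?cx2 mul0r.
Qed.

Lemma ler_norm_lift_up g B c : (forall x, `|g x| <= B) ->
  `|lift_up g c| <= B * population c.
Proof.
move=> gB; rewrite lift_upE (le_trans (ler_normB _ _))// /population mulrDr.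
by apply: lerD; rewrite (le_trans (ler_norm_sum _ _ _))// mulr_sumr;
  apply: ler_sum => x _; rewrite mulr1.
Qed.

Lemma gen_asummable g B x : (forall y, `|g y| <= B) ->
  asummable (fun y => r x y * (g y - g x)).
Proof.
move=> gB; apply: (@le_asummable _ _ (fun y => 2 * B * `|r x y|)).
  move=> y; rewrite normrM mulrC ler_wpM2r// (le_trans (ler_normB _ _))//.
  by rewrite mulr_natl mulr2n lerD.
exact/asummableZ/asummable_norm.
Qed.

Lemma ler_norm_gen g B x : (forall y, `|g y| <= B) -> `|gen r g x| <= 2 * K * B.
Proof.
move=> gB; have B0 : 0 <= B by rewrite (le_trans _ (gB x)).
have sg := gen_asummable x gB.
rewrite (le_trans (ler_norm_asum sg))//.
apply: (@le_trans _ _ (asum (fun y => 2 * B * `|r x y|))).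
  apply: ler_asum; [exact: asummable_norm|exact/asummableZ/asummable_norm|].
  move=> y; rewrite normrM mulrC ler_wpM2r// (le_trans (ler_normB _ _))//.
  by rewrite mulr_natl mulr2n lerD.
rewrite asumZ; last exact: asummable_norm.
by rewrite -[leRHS]mulrA [K * B]mulrC [leRHS]mulrA ler_wpM2l// mulr_ge0.
Qed.

(** Branching from [x] to [y] changes the lift by exactly the opposite of what a jump of the same
    particle would do, so the rates combine to [rpos - rneg = r]. Antiparticles produce the same
    terms with a global minus sign, as [lift_up] requires. *)
Lemma gen_up_lift_up g B c : (forall x, `|g x| <= B) ->
  gen_up r (lift_up g) c = lift_up (gen r g) c.
Proof.
move=> gB; have srd (b : bool) x : asummable (fun y => rate b x y * (g y - g x)).
  apply: (@le_asummable _ _ (fun y => 2 * B * rate b x y)); last first.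
    exact/asummableZ/rate_sum.
  move=> y; rewrite normrM (ger0_norm (rate_ge0 b x y)) mulrC ler_wpM2r ?rate_ge0//.
  by rewrite (le_trans (ler_normB _ _))// mulr_natl mulr2n lerD.
(* The sign of the increment: one factor for the type of the particle, one for jump or branching. *)
pose e a b : R := (if a then 1 else -1) * (if b then 1 else -1).
have H a b : flow a b (lift_up g) c =
    e a b * \sum_(x <- source a c) asum (fun y => rate b x y * (g y - g x)).
  transitivity (\sum_(x <- source a c) asum (fun y => rate b x y * (e a b * (g y - g x)))).
    apply: (proj2 (flowE (phi := fun z => e a b * (g z.2 - g z.1)) _ _)); last first.
      by move=> x; under eq_fun do rewrite mulrCA; exact: asummableZ.
    move=> [x y] /= xA; rewrite !lift_upE /e.
    by case: a b xA => -[] /= xA; rewrite ?sum_msetD ?sum_mset1 ?sum_mset_move//; ring.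
  rewrite mulr_sumr; apply: eq_bigr => x _; rewrite -asumZ//.
  by apply: eq_asum => y; rewrite mulrCA.
have D (A : {mset E}%mset) :
    \sum_(x <- A) asum (fun y => rate true x y * (g y - g x)) -
    \sum_(x <- A) asum (fun y => rate false x y * (g y - g x)) = \sum_(x <- A) gen r g x.
  rewrite -sumrB; apply: eq_bigr => x _; rewrite -asumB//.
  by apply: eq_asum => y; rewrite -mulrBl rateB.
rewrite gen_upE !H lift_upE -!D /e /=; ring.
Qed.

End BranchingGenerator.

(** * Taylor polynomials of the semigroup *)

Section TaylorSolution.
Context {R : realType} {E : countType}.
Variables (r : E -> E -> R) (K : R).
Hypothesis r_sum : forall x, asummable (r x).
Hypothesis r_le : forall x, asum (fun y => `|r x y|) <= K.
Hypothesis K_ge0 : 0 <= K.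
Variables (f : E -> R) (B : R).
Hypothesis B_ge0 : 0 <= B.
Hypothesis f_le : forall x, `|f x| <= B.
Implicit Types (c : config E) (t T : R) (n N : nat).

Let L n := lift_up (iter n (gen r) f).

Lemma ler_norm_iter_gen n x : `|iter n (gen r) f x| <= (2 * K) ^+ n * B.
Proof.
elim: n x => [|n IH] x; first by rewrite expr0 mul1r.
by rewrite iterS exprS -mulrA; exact: (ler_norm_gen r_sum r_le).
Qed.

Lemma ler_norm_lift_iter n c : `|L n c| <= (2 * K) ^+ n * B * population c.
Proof. exact/ler_norm_lift_up/ler_norm_iter_gen. Qed.

Lemma population_le_weight c : (population c : R) <= weight c.
Proof. rewrite /weight; have := population_ge0 (R := R) c; nra. Qed.

Lemma lift_iter_dominated n : dominated weight (L n).
Proof.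
exists ((2 * K) ^+ n * B) => c; apply: le_trans (ler_norm_lift_iter n c) _.
by rewrite ler_wpM2l ?population_le_weight// mulr_ge0// exprn_ge0// mulr_ge0.
Qed.

Definition taylor N t c : R := \sum_(n < N.+1) t ^+ n / n`!%:R * L n c.
Definition taylor' N t c : R := \sum_(n < N) t ^+ n / n`!%:R * L n.+1 c.

Lemma taylor_derive N t c : is_derive t (1 : R) (taylor N ^~ c) (taylor' N t c).
Proof.
elim: N => [|N IH].
  rewrite /taylor /taylor' big_ord0; under eq_fun do rewrite big_ord1 expr0.
  exact: is_derive_cst.
have e : taylor N.+1 ^~ c = (fun s => taylor N s c + s ^+ N.+1 * (N.+1`!%:R^-1 * L N.+1 c)).
  by apply/funext => s; rewrite /taylor big_ord_recr /= mulrA.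
rewrite e; have dX : is_derive t (1 : R) (fun s : R => s ^+ N.+1) (N.+1%:R * t ^+ N).
  by split; [exact: exprn_derivable|rewrite exp_derive /GRing.scale /= mulr1].
have H := is_deriveD IH (is_deriveM dX (is_derive_cst (N.+1`!%:R^-1 * L N.+1 c) t (1 : R))).
apply: is_derive_eq H _; rewrite /GRing.scale /= mulr0 add0r /taylor' big_ord_recr /=.
congr (_ + _); rewrite factS natrM.
have fN0 : N`!%:R != 0 :> R by rewrite pnatr_eq0 -lt0n fact_gt0.
have sN0 : 1 + N%:R != 0 :> R by rewrite nat1r pnatr_eq0.
by field; rewrite fN0 sN0.
Qed.

Lemma taylor_dominated N t : dominated weight (taylor N t).
Proof.
rewrite /taylor; elim: N.+1 => [|n [A HA]].
  by exists 0 => c; rewrite big_ord0 normr0 mul0r.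
have [A' HA'] := lift_iter_dominated n.
exists (A + `|t ^+ n / n`!%:R| * A') => c; rewrite big_ord_recr /= (le_trans (ler_normD _ _))//.
by rewrite mulrDl lerD// normrM -mulrA ler_wpM2l.
Qed.

Lemma gen_up_taylor N t c :
  gen_up r (taylor N t) c = \sum_(n < N.+1) t ^+ n / n`!%:R * L n.+1 c.
Proof.
have GL n : gen_up r (L n) c = L n.+1 c.
  by apply: (gen_up_lift_up r_sum) => y; exact: ler_norm_iter_gen.
elim: N => [|N IH].
  have -> : taylor 0 t = L 0%N.
    by apply/funext => c'; rewrite /taylor big_ord1 expr0 fact0 divr1 mul1r.
  by rewrite GL big_ord1 expr0 fact0 divr1 mul1r.
have e : taylor N.+1 t = (fun c' => taylor N t c' + (t ^+ N.+1 / N.+1`!%:R) * L N.+1 c').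
  by apply/funext => c'; rewrite /taylor big_ord_recr.
rewrite e gen_up_linear//; [|exact: taylor_dominated|exact: lift_iter_dominated].
by rewrite IH GL [RHS]big_ord_recr.
Qed.

(** Differentiation in time shifts the coefficients as the generator does but loses one degree, so
    only the top term remains. Its bound is the [delta] of the comparison. *)
Lemma taylor_defect N t c :
  gen_up r (taylor N t) c - taylor' N t c = t ^+ N / N`!%:R * L N.+1 c.
Proof. by rewrite gen_up_taylor big_ord_recr /= addrAC subrr add0r. Qed.

Definition taylor_bound N T : R := \sum_(n < N.+1) T ^+ n / n`!%:R * ((2 * K) ^+ n * B).

Lemma taylor_bound_ge0 N T : 0 <= T -> 0 <= taylor_bound N T.
Proof.
by move=> T0; apply: sumr_ge0 => n _; rewrite !mulr_ge0 ?exprn_ge0 ?invr_ge0 ?mulr_ge0.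
Qed.

Lemma ler_norm_taylor N t T c : 0 <= t <= T ->
  `|taylor N t c| <= taylor_bound N T * population c.
Proof.
move=> /andP[t0 tT]; rewrite (le_trans (ler_norm_sum _ _ _))// mulr_suml.
apply: ler_sum => n _; rewrite normrM -mulrA ler_pM//; last exact: ler_norm_lift_iter.
rewrite ger0_norm ?mulr_ge0 ?exprn_ge0 ?invr_ge0// ler_wpM2r ?invr_ge0//.
by apply: lerXn2r; rewrite ?nnegrE// (le_trans t0).
Qed.

Lemma taylor_far N T (e : R) : 0 <= T -> 0 < e -> exists M : R, forall t c, 0 <= t <= T ->
  M < weight c -> `|taylor N t c| <= e * weight c.
Proof.
(* Beyond weight a^2 one has n + 1 > a for the population n, so the linear bound e a n is at most e
   (n+1)^2. *)
move=> T0 e0; pose a := taylor_bound N T / e.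
have a0 : 0 <= a by rewrite mulr_ge0 ?taylor_bound_ge0// invr_ge0 ltW.
exists (a ^+ 2) => t c tI; rewrite /weight => aw.
have p0 := population_ge0 (R := R) c.
have ap : a < population c + 1.
  by rewrite ltNge; apply/negP => ha; nra.
have ea : taylor_bound N T = e * a by rewrite /a mulrC divfK// gt_eqF.
apply: le_trans (ler_norm_taylor N c tI) _; rewrite ea -mulrA ler_wpM2l ?ltW//.
nra.
Qed.

Variable p : R -> config E -> config E -> R.
Hypotheses (p_tf : transition_function p) (p_gen : has_generator p (gen_up r)).

Lemma transition_lift_asummable t c : 0 <= t ->
  asummable (fun c' => p t c c' * lift_up f c').
Proof.
move=> t0.
apply: (@transition_mul_dominated_asummable _ _ p (gen_up r) p_tf p_gen weight K
  (@weight_ge1 R E) (gen_up_cst r) (gen_up_linear r_sum) K_ge0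
  (gen_up_ge0 r_sum r_le K_ge0) (4 * K)) => //.
- by rewrite mulr_ge0.
- exact: (gen_up_weight_le r_sum r_le K_ge0).
- exact: lift_iter_dominated 0%N.
Qed.

Lemma transition_lift_taylor N t c : 0 <= t ->
  `|transition_op p t (lift_up f) c - taylor N t c| <=
  t ^+ N / N`!%:R * ((2 * K) ^+ N.+1 * B) * t * expR (4 * K * t) * weight c.
Proof.
move=> t0; have -> : lift_up f = taylor N 0.
  apply/funext => c'; rewrite /taylor big_ord_recl expr0 fact0 divr1 mul1r big1 ?addr0//.
  by move=> i _; rewrite expr0n /= !mul0r.
apply: (@transition_op_approx_norm _ _ p (gen_up r) p_tf p_gen weight K
  (@weight_ge1 R E) (gen_up_cst r) (gen_up_linear r_sum) K_ge0
  (gen_up_ge0 r_sum r_le K_ge0) (4 * K) _ (gen_up_weight_le r_sum r_le K_ge0)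
  t (taylor_bound N t) _ (taylor N) (taylor' N)) => //.
- by rewrite mulr_ge0.
- by rewrite !mulr_ge0 ?exprn_ge0 ?invr_ge0 ?mulr_ge0.
- move=> s c' sI; apply: le_trans (ler_norm_taylor N c' sI) _.
  by rewrite ler_wpM2l ?taylor_bound_ge0 ?population_le_weight.
- by move=> e e0; exact: taylor_far.
- by move=> s c' _; exact: taylor_derive.
- move=> s c' /andP[s0 st]; rewrite taylor_defect normrM -mulrA.
  rewrite ler_pM//.
    rewrite ger0_norm ?mulr_ge0 ?exprn_ge0 ?invr_ge0// ler_wpM2r ?invr_ge0//.
    by apply: lerXn2r; rewrite ?nnegrE.
  apply: le_trans (ler_norm_lift_iter _ _) _.
  by rewrite ler_wpM2l ?population_le_weight// mulr_ge0// exprn_ge0// mulr_ge0.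
- by rewrite t0 lexx.
Qed.

(** At a single particle in [x], [lift_up] is evaluation at [x]: the Taylor polynomials become the
    partial sums defining [semigroup], and [transition_lift_taylor] identifies their limit. *)
Lemma transition_lift_semigroup t x : 0 <= t ->
  transition_op p t (lift_up f) ([mset x], mset0)%mset = semigroup r t f x.
Proof.
move=> t0; set c := ([mset x], mset0)%mset; set l := transition_op _ _ _ _.
apply/esym/cvg_lim; first exact: Rhausdorff.
have lc n : L n c = iter n (gen r) f x.
  by rewrite /L lift_upE /= sum_mset1 sum_mset0 subr0.
have e N : series (fun n => t ^+ n / n`!%:R * iter n (gen r) f x) N.+1 = taylor N t c.
  by rewrite /series /= big_mkord; apply: eq_bigr => n _; rewrite lc.
(* [taylor N] has [N.+1] terms, hence the shift by one. *)
rewrite -cvg_shiftS; under eq_fun do rewrite e.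
(* [C] collects the factors of the error bound that do not depend on [N], including one [2 * K] from
   the power [N.+1]. *)
pose C := 2 * K * B * t * expR (4 * K * t) * weight c.
have dc : (2 * K * t) ^+ N / N`!%:R * C @[N --> \oo] --> (0 : R).
  suff : (2 * K * t) ^+ N / N`!%:R * C @[N --> \oo] --> 0 * C by rewrite mul0r.
  by apply: cvgM; [exact: pi_irrational.exp_fact|exact: cvg_cst].
apply/subr_cvg0; apply: norm_cvg0; apply: (squeeze_cvgr _ (cvg_cst 0) dc).
near=> N; rewrite normr_ge0 /= distrC (le_trans (transition_lift_taylor N c t0))//.
by rewrite /C [(2 * K * t) ^+ N]exprMn exprS le_eqVlt; apply/orP; left; apply/eqP; ring.
Unshelve. all: by end_near. Qed.

End TaylorSolution.

(** * The law of the process and the conclusion *)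

Lemma markov_transition {R : realType} {S : countType} (d : measure_display)
  (Omega : measurableType d) (P : probability Omega R) (X : R -> Omega -> S)
  (p : R -> S -> S -> R) (c0 : S) :
  (forall (t : R) (c : S), 0 <= t -> measurable (X t @^-1` [set c])) ->
  P (X 0 @^-1` [set c0]) = 1%E -> markov_property P X p ->
  forall t c, 0 <= t -> P (X t @^-1` [set c]) = (p t c0 c)%:E.
Proof.
move=> mX P0 markov t c t0; have m0 := mX 0 c0 (lexx 0).
have FT : natural_filtration X 0 setT.
  by move=> B [[B0 BC _] _]; rewrite -(setD0 setT); exact: BC.
(* The Markov property at time 0 is used with the sure event. Since the start is [c0] almost surely,
   intersecting with [X 0 = c0] loses no mass. *)
have := markov 0 t setT c0 c (lexx 0) t0 FT.
rewrite !setTI add0r P0 mul1e => <-.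
have mt := mX t c t0.
have dn : P (X t @^-1` [set c] `\` X 0 @^-1` [set c0]) = 0%E.
  apply: (subset_measure0 (B := ~` (X 0 @^-1` [set c0]))).
  - exact: measurableD.
  - exact: measurableC.
  - by move=> w [].
  - by apply: etrans (probability_setC P m0) _; rewrite P0 subee.
transitivity (P (X t @^-1` [set c] `\` X 0%R @^-1` [set c0]) +
  P (X t @^-1` [set c] `&` X 0%R @^-1` [set c0]))%E; first exact: measureDI.
by rewrite dn add0e setIC.
Qed.

Theorem theorem3p1 (R : realType) (E : countType) (r : E -> E -> R)
  (r_diag : forall x : E, r x x = 0)
  (r_bound : (ereal_sup (range (fun x : E =>
                \esum_(y in [set: E]) `|r x y|%:E)) < +oo)%E)
  (f : E -> R) (f_bounded : bounded_fun f)
  (x : E) (t : R) (t_ge0 : 0 <= t)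
  (d : measure_display) (Omega : measurableType d) (P : probability Omega R)
  (eta : R -> Omega -> config E)
  (eta_process :
     markov_jump_process (gen_up r) ([mset x], mset0)%mset P eta) :
  (semigroup r t f x)%:E = ('E_P[fun w => lift_up f (eta t w)])%E.
Proof.
have [B fB] := (bounded_funP f).1 f_bounded.
have B0 : 0 <= B by rewrite (le_trans _ (fB x)).
(* [fine M] serves as the constant [K]. The site [x] shows that the supremum is nonnegative, as it
   is not taken over an empty set. *)
set M := ereal_sup _ in r_bound.
have rM y : (\esum_(z in [set: E]) `|r y z|%:E <= M)%E.
  by apply: ereal_sup_ubound; exists y.
have M0 : (0 <= M)%E by apply: le_trans (rM x); apply: esum_ge0 => z _; rewrite lee_fin.
have MK : M = (fine M)%:E by rewrite fineK// ge0_fin_numE.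
have r_sum y : asummable (r y) by exact: le_lt_trans (rM y) r_bound.
have r_le y : asum (fun z => `|r y z|) <= fine M.
  by rewrite -lee_fin -MK EFin_asum//; exact: asummable_norm.
have K0 : 0 <= fine M by exact: fine_ge0.
have [mX P0 _ [p [p_tf p_gen markov]]] := eta_process.
have PX := markov_transition mX P0 markov.
have sl := transition_lift_asummable r_sum r_le K0 B0 fB p_tf p_gen ([mset x], mset0)%mset t_ge0.
rewrite (expectation_countable _ (fun c => PX t c t_ge0) sl); last by move=> c; exact: mX.
by rewrite -(transition_lift_semigroup r_sum r_le K0 B0 fB p_tf p_gen x t_ge0).
Qed.
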